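(* Let $\delta\in(0,\infty)$ and $c,\tilde c\in(0,1]$. Let $(\alpha,\beta,\kappa,\nu)\in\mathbb R_{>0}^4$ be a solution of System A$(\ell,\phi,c\delta)$ and let $(\tilde\alpha,\tilde\beta,\tilde\kappa,\tilde\nu)\in\mathbb R_{>0}^4$ be a solution of System A$(\tilde\ell,\tilde\phi,\tilde c\delta)$. Then the functions $F_\ell,F_\phi:[-1,1]\to\mathbb R$ defined in the context satisfy: 1. $|F_\ell(\eta_G)|\le\sqrt{c\tilde c}$ and $|F_\phi(\eta_H)|\le 1$ for all $\eta_G\in[-1,1]$ and $\eta_H\in[-1,1]$. 2. $F_\ell$ and $F_\phi$ are non-decreasing and differentiable, and the compositions $F_\ell\circ F_\phi$ and $F_\phi\circ F_\ell$ are $\min\{c,\tilde c\}$-Lipschitz. 3. The system of equations $\eta_G=F_\phi(\eta_H)$, $\eta_H=F_\ell(\eta_G)$ in the variables $(\eta_G,\eta_H)\in[-1,1]^2$ admits a unique solution $(\eta_G^\star,\eta_H^\star)$, and $(\eta_G^\star,\eta_H^\star)\in[-1,1]\times[-\sqrt{c\tilde c},\sqrt{c\tilde c}]$.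
   Context: $F_\theta$ and $F_z$ are probability distributions on $\mathbb R$. $\ell,\tilde\ell:\mathbb R\to\mathbb R$ are convex functions (losses) and $\phi,\tilde\phi:\mathbb R\to\mathbb R\cup\{+\infty\}$ are proper, closed, convex functions (regularizers). For a proper closed convex $f:\mathbb R\to\mathbb R\cup\{+\infty\}$, $\tau>0$ and $x\in\mathbb R$: $\mathrm{prox}_f(x;\tau)=\arg\min_{y\in\mathbb R}\{f(y)+\frac1{2\tau}(x-y)^2\}$, $\mathrm{env}_f(x;\tau)=\min_{y\in\mathbb R}\{f(y)+\frac1{2\tau}(x-y)^2\}$, and $\mathrm{env}_f'(x;\tau)=\frac{\partial}{\partial x}\mathrm{env}_f(x;\tau)=\frac1\tau(x-\mathrm{prox}_f(x;\tau))$. System A$(\ell,\phi,c\delta)$ is the following system in $(\alpha,\beta,\kappa,\nu)\in\mathbb R_{>0}^4$: $$\alpha^2=\mathbb E\Big[\big(\tfrac1\nu\mathrm{env}_\phi'(\Theta+\tfrac\beta\nu H;\tfrac1\nu)-\tfrac\beta\nu H\big)^2\Big],\qquad \beta^2=c\delta\,\mathbb E\big[\mathrm{env}_\ell'(Z+\alpha G;\kappa)^2\big],$$ $$\kappa\beta=\mathbb E\Big[\big(\tfrac1\nu\mathrm{env}_\phi'(\Theta+\tfrac\beta\nu H;\tfrac1\nu)-\tfrac\beta\nu H\big)(-H)\Big],\qquad \nu\alpha=c\delta\,\mathbb E\big[\mathrm{env}_\ell'(Z+\alpha G;\kappa)\,G\big],$$ where $H\sim N(0,1)$, $G\sim N(0,1)$,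 $\Theta\sim F_\theta$, $Z\sim F_z$ are mutually independent. The functions $F_\ell,F_\phi:[-1,1]\to\mathbb R$ are $$F_\ell(\eta_G)=\frac{c\tilde c\delta}{\beta\tilde\beta}\,\mathbb E\big[\mathrm{env}_\ell'(Z+\alpha G;\kappa)\,\mathrm{env}_{\tilde\ell}'(Z+\tilde\alpha\tilde G;\tilde\kappa)\big],$$ $$F_\phi(\eta_H)=\frac1{\alpha\tilde\alpha}\,\mathbb E\Big[\big(\tfrac1\nu\mathrm{env}_\phi'(\Theta+\tfrac\beta\nu H;\tfrac1\nu)-\tfrac\beta\nu H\big)\big(\tfrac1{\tilde\nu}\mathrm{env}_{\tilde\phi}'(\Theta+\tfrac{\tilde\beta}{\tilde\nu}\tilde H;\tfrac1{\tilde\nu})-\tfrac{\tilde\beta}{\tilde\nu}\tilde H\big)\Big],$$ where $(G,\tilde G)$ is centered bivariate Gaussian with unit variances and correlation $\eta_G$, $(H,\tilde H)$ is centered bivariate Gaussian with unit variances and correlation $\eta_H$, $\Theta\sim F_\theta$, $Z\sim F_z$, and $(G,\tilde G)$, $(H,\tilde H)$, $\Theta$, $Z$ are mutually independent. *)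

(* Defs.v *)
From HB Require Import structures.
From mathcomp Require Import all_boot all_order all_algebra.
From mathcomp Require Import all_classical all_reals all_analysis.
From mathcomp Require Import measurable_realfun.

Set Implicit Arguments.
Unset Strict Implicit.
Unset Printing Implicit Defensive.

Import Order.TTheory GRing.Theory Num.Theory.
Import numFieldNormedType.Exports.

Local Open Scope classical_set_scope.
Local Open Scope ring_scope.

Section convex_analysis.
Context {R : realType}.

(* Functions R -> R ∪ {+oo} are encoded as R -> \bar R avoiding -oo, which is
   part of properness. *)
Definition proper_fun (f : R -> \bar R) : Prop :=
  (forall x, f x != -oo%E) /\ (exists x, f x != +oo%E).

(* The library's [convex_function] only covers real-valued functions.  The
   conventions 0 * +oo = 0 and f > -oo make the endpoints t = 0, 1 harmless. *)
Definition econvex (f : R -> \bar R) : Prop :=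
  forall (t x y : R), 0 <= t <= 1 ->
    (f (t * x + (1 - t) * y)%R <= t%:E * f x + (1 - t)%:E * f y)%E.

Definition proper_closed_convex (f : R -> \bar R) : Prop :=
  [/\ proper_fun f, lower_semicontinuous f & econvex f].

(* env_f(x; tau); for tau > 0 and f proper closed convex the infimum is finite
   and attained at a unique point, prox_f(x; tau). *)
Definition env (f : R -> \bar R) (tau x : R) : \bar R :=
  ereal_inf (range (fun y => f y + ((2 * tau)^-1 * (x - y) ^+ 2)%:E)%E).

(* Also equal to (x - prox_f(x; tau)) / tau; note that tau comes before x. *)
Definition env' (f : R -> \bar R) (tau x : R) : R :=
  derive1 (fun u => fine (env f tau u)) x.

End convex_analysis.

Section gaussian.
Context {R : realType}.

Definition std_normal : probability (measurableTypeR R) R := normal_prob 0 1.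

Definition correlate (rho : R)
    (w : measurableTypeR R * measurableTypeR R) :
    measurableTypeR R * measurableTypeR R :=
  (w.1, rho * w.1 + Num.sqrt (1 - rho ^+ 2) * w.2).

Lemma measurable_correlate rho : measurable_fun setT (correlate rho).
Proof.
apply/measurable_fun_pair => /=; first exact: measurable_fst.
apply: measurable_funD; apply: measurable_funM; try exact: measurable_cst.
- exact: measurable_fst.
- exact: measurable_snd.
Qed.

HB.instance Definition _ rho :=
  isMeasurableFun.Build _ _ _ _ (correlate rho) (measurable_correlate rho).

(* Centered bivariate Gaussian law with unit variances and correlation rho in
   [-1, 1]: the law of A W, for W a standard Gaussian vector and A the Cholesky
   factor of the covariance matrix [[1, rho], [rho, 1]].  This includes the
   degenerate cases rho = 1 and rho = -1. *)
Definition bigauss (rho : R) :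
    probability (measurableTypeR R * measurableTypeR R)%type R :=
  distribution (std_normal \x std_normal)%E (correlate rho).

End gaussian.

Section system.
Context {R : realType}.
Variables (Ftheta Fz : probability (measurableTypeR R) R).

Definition residual (phi : R -> \bar R) (beta nu theta h : R) : R :=
  nu^-1 * env' phi nu^-1 (theta + beta / nu * h) - beta / nu * h.

Definition score (ell : R -> R) (alpha kappa z g : R) : R :=
  env' (EFin \o ell) kappa (z + alpha * g).

(* Each expectation involves only (Theta, H) or (Z, G), so it is taken under the
   joint law of that independent pair, a product measure.  Expectations are
   extended-real valued: the first two equations force square integrability,
   hence integrability of all the other integrands. *)
Record systemA (ell : R -> R) (phi : R -> \bar R) (cdelta : R)
    (alpha beta kappa nu : R) : Prop := SystemA {
  systemA_alpha_gt0 : 0 < alpha ;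
  systemA_beta_gt0 : 0 < beta ;
  systemA_kappa_gt0 : 0 < kappa ;
  systemA_nu_gt0 : 0 < nu ;
  systemA_alpha : ((alpha ^+ 2)%:E =
    'E_(Ftheta \x std_normal)
      [fun w => (residual phi beta nu w.1 w.2 ^+ 2)%R])%E ;
  systemA_beta : ((beta ^+ 2)%:E =
    cdelta%:E * 'E_(Fz \x std_normal)
      [fun w => (score ell alpha kappa w.1 w.2 ^+ 2)%R])%E ;
  systemA_kappa : ((kappa * beta)%:E =
    'E_(Ftheta \x std_normal)
      [fun w => (residual phi beta nu w.1 w.2 * - w.2)%R])%E ;
  systemA_nu : ((nu * alpha)%:E =
    cdelta%:E * 'E_(Fz \x std_normal)
      [fun w => (score ell alpha kappa w.1 w.2 * w.2)%R])%E }.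

(* In F_ell and F_phi the argument is the correlation, and the law of
   (Z, (G, G~)), resp. (Theta, (H, H~)), is the product [_ \x bigauss eta].
   They are total functions, meaningful on [-1, 1] only. *)
Definition F_ell (delta c ct : R) (ell ellt : R -> R)
    (alpha beta kappa alphat betat kappat : R) (eta : R) : R :=
  c * ct * delta / (beta * betat) *
  fine ('E_(Fz \x bigauss eta)
    [fun w => (score ell alpha kappa w.1 w.2.1 *
               score ellt alphat kappat w.1 w.2.2)%R])%E.

Definition F_phi (phi phit : R -> \bar R)
    (alpha beta nu alphat betat nut : R) (eta : R) : R :=
  (alpha * alphat)^-1 *
  fine ('E_(Ftheta \x bigauss eta)
    [fun w => (residual phi beta nu w.1 w.2.1 *
               residual phit betat nut w.1 w.2.2)%R])%E.

End system.

(* Differentiability of F at every point of A along A; at an endpoint of an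
   interval this is one-sided differentiability. *)
Definition differentiable_within {R : realType} (A : set R) (F : R -> R) : Prop :=
  forall x, A x -> cvg ((fun y => (F y - F x) / (y - x)) @ within A x^').

(* Main.v *)
Require Import Defs.
From HB Require Import structures.
From mathcomp Require Import all_boot all_order all_algebra.
From mathcomp Require Import all_classical all_reals all_analysis.
From mathcomp Require Import measurable_realfun.
From mathcomp Require Import ring lra.

Import Order.TTheory GRing.Theory Num.Theory.
Import numFieldNormedType.Exports.

Set Implicit Arguments.
Unset Strict Implicit.
Unset Printing Implicit Defensive.

Local Open Scope classical_set_scope.
Local Open Scope ring_scope.

(* Write N_t = cos t X + sin t W for a standard Gaussian pair (X, W). Rotation invariance
   of the plane Gaussian law gives E f(N_s) g(N_t) = B(cos (s - t)), where
   B(eta) = E f(X) g(X_eta) is the correlation of f and g at correlation eta, and hence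
     E (f(N_s) - f(N_s'))(g(N_t) - g(N_t'))
       = B(cos(s-t)) - B(cos(s-t')) - B(cos(s'-t)) + B(cos(s'-t')).
   - Monotonicity: for the symmetric angles s, s' = p, -p and t, t' = q, -q both increments
     of N are multiples of W of the same sign, so the left-hand side is nonnegative for
     nondecreasing f, g, while the right-hand side is 2 B(cos(p-q)) - 2 B(cos(p+q)).
   - Lipschitz constant: if g has slope at most K, apply monotonicity to f and K x - g; this
     bounds the increments of B by K E[f(X) X] times those of eta, and System A evaluates
     E[f(X) X]. The constants of F_ell and F_phi multiply to c or to c~. The bound for F_ell
     is strict, because the proximal map of a finite convex function is not constant: this
     gives uniqueness even when c = c~ = 1.
   - Differentiability in the interior: the left-hand side is O(|s-s'| |t-t'|), so the
     increments of B o cos are additive up to a quadratic error.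
   - Differentiability at the end points: by polarization and eta -> -eta one may take f = g
     and eta -> 1. There B(1) - B(cos t) is half the square of the L2 norm of
     f(N_t) - f(N_0), which is subadditive in t. *)

(** * Difference quotients *)

Section subadditive_slope.
Context {R : realType}.

(* Fekete's lemma at 0: the limit is the supremum of s x / x. *)
Lemma subadditive_slope_cvg (s : R -> R) (C : R) :
    (forall x y, 0 <= x -> 0 <= y -> s (x + y) <= s x + s y) -> s 0 = 0 ->
    (forall x, 0 < x -> s x <= C * x) ->
  cvg (s x / x @[x --> 0^'+]).
Proof.
move=> sD s0 sC.
pose A := [set s x / x | x in [set x | 0 < x]].
have hA : has_sup A.
  split; first by exists (s 1 / 1), 1 => //=.
  exists C => _ [x /= x0 <-]; rewrite ler_pdivrMr//; exact: sC.
have le_sup x : 0 <= x -> s x <= sup A * x.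
  rewrite le_eqVlt => /predU1P[<-|x0]; first by rewrite s0 mulr0.
  by rewrite -ler_pdivrMr//; apply: sup_upper_bound => //; exists x.
have sMn n y : 0 <= y -> s (n%:R * y) <= n%:R * s y.
  move=> y0; elim: n => [|n IH]; first by rewrite !mul0r s0.
  rewrite -natr1 !mulrDl !mul1r (le_trans (sD _ _ _ _)) ?lerD2r//.
  by rewrite mulr_ge0.
apply/cvg_ex; exists (sup A); apply/cvgrPdist_le => e e0.
have [_ [x0 /= x0_gt0 <-] hx0] := sup_adherent (divr_gt0 e0 (ltr0Sn R 1)) hA.
near=> y.
have y0 : 0 < y by [].
have y2 : y <= x0 / 2.
  near: y; apply: nbhs_right_le; exact: divr_gt0.
have := le_sup _ (ltW y0); rewrite -ler_pdivrMr// => syl.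
rewrite ger0_norm ?subr_ge0//.
(* Write [x0 = n * y + r] with [0 <= r < y]. Subadditivity hands the near-optimal slope at [x0] down
   to [y]; as [y <= x0 / 2] forces [n * y >= x0 / 2], the error [e / 2] at [x0] becomes at most [e]
   at [y]. *)
pose n := Num.truncn (x0 / y).
have /andP[nx xn] : n%:R <= x0 / y < n.+1%:R.
  by apply: truncn_itv; rewrite ltW// divr_gt0.
rewrite ler_pdivlMr// in nx; rewrite ltr_pdivrMr// in xn.
have hr : 0 <= x0 - n%:R * y by rewrite subr_ge0.
have h1 : s x0 <= n%:R * s y + sup A * (x0 - n%:R * y).
  rewrite -{1}(subrK (n%:R * y) x0) addrC (le_trans (sD _ _ _ _))//.
    by rewrite mulr_ge0// ltW.
  by rewrite lerD ?sMn ?le_sup// ltW.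
rewrite ltr_pdivlMr// in hx0.
rewrite -natr1 mulrDl mul1r in xn.
have ny0 : 0 < n%:R * y by lra.
rewrite lerBlDl -lerBlDr ler_pdivlMr//.
have n0 : 0 < n%:R :> R by rewrite -(pmulr_lgt0 _ y0).
rewrite -(ler_pM2l n0) mulrA.
have -> : n%:R * (sup A - e) * y = sup A * (n%:R * y) - e * (n%:R * y) by ring.
have : e * (n%:R * y) >= e * (x0 / 2).
  by rewrite ler_pM2l//; lra.
have -> : e * (x0 / 2) = (e / 2) * x0 by ring.
rewrite mulrBl in hx0.
have : sup A * (x0 - n%:R * y) = sup A * x0 - sup A * (n%:R * y) by ring.
lra.
Unshelve. all: by end_near.
Qed.

End subadditive_slope.

(** * Derivatives from mixed second differences, and the limit of [sin x / x] *)

Section derivability.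
Context {R : realType}.

(* The increment of Phi at x, corrected by C k^2 / 2, is superadditive in k > 0. *)
Lemma derivable_mixed_difference (Phi : R -> R) (C D : R) (x : R) :
    (forall k m, `|Phi (x + (k + m)) - Phi (x + k) - Phi (x + m) + Phi x|
       <= C * (`|k| * `|m|)) ->
    (forall k, `|Phi (x + k) - Phi x| <= D * `|k|) ->
  derivable Phi x 1.
Proof.
move=> hC hD.
pose h k := Phi (x + k) - Phi x.
pose s k := - (h k + C / 2 * k ^+ 2).
have h0 : h 0 = 0 by rewrite /h addr0 subrr.
have C0 : 0 <= C by have := hC 1 1; rewrite normr1 !mulr1; exact: le_trans.
have /cvg_ex[l /= sl] : cvg (s k / k @[k --> 0^'+]).
  apply: (@subadditive_slope_cvg _ _ D).
  - move=> k m k0 m0; have := hC k m; rewrite (ger0_norm k0) (ger0_norm m0) ler_norml => /andP[+ _].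
    by rewrite /s /h; nra.
  - by rewrite /s h0 expr0n mulr0 addr0 oppr0.
  - move=> k k0; have := hD k; rewrite ler_norml gtr0_norm// => /andP[+ _].
    by rewrite /s /h; nra.
apply/cvg_ex; exists (- l); apply/cvgrPdist_le => e e0.
move/cvgrPdist_le : sl => /(_ _ (divr_gt0 e0 (ltr0Sn R 1))) [d /= d0 hd].
have C10 : 0 < C + C + 1 by lra.
near=> k.
have k0 : k != 0 by near: k; exact: nbhs_dnbhs_neq.
have kd : `|k| < d.
  by near: k; apply: dnbhs0_lt.
have ke : `|k| < e / 2 / (C + C + 1).
  by near: k; apply: dnbhs0_lt; rewrite !divr_gt0.
have k0' : 0 < `|k| by rewrite normr_gt0.
have := hd `|k|; rewrite /= sub0r normrN normr_id => /(_ kd k0').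
rewrite -[k%:A]/(k * 1) mulr1 (addrC k x) -/(h k) -[_ *: _]/(_ * _).
have -> : l - s `|k| / `|k| = l + h `|k| / `|k| + C / 2 * `|k|.
  by rewrite /s; field; rewrite normr_eq0.
(* The left quotients follow the right ones: the mixed difference at [k] and [- k] bounds
   [h k + h (- k)] by [C * k ^+ 2]. *)
have hk : `|k^-1 * h k - h `|k| / `|k| | <= C * `|k|.
  have [kp|kn] := leP 0 k.
    by rewrite (ger0_norm kp) (mulrC _ (h k)) subrr normr0 mulr_ge0.
  rewrite (ltr0_norm kn); have := hC k (- k); rewrite subrr addr0 normrN.
  have -> : Phi x - Phi (x + k) - Phi (x + - k) + Phi x = - (h k + h (- k)).
    by rewrite /h; ring.
  rewrite normrN mulrA => hh.
  have -> : k^-1 * h k - h (- k) / (- k) = (h k + h (- k)) / k.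
    by field.
  rewrite normrM normfV ler_pdivrMr//.
  by move: hh; rewrite (ltr0_norm kn).
have ke2 : (C + C + 1) * `|k| < e / 2.
  by rewrite mulrC -ltr_pdivlMr.
move: hk; rewrite !ler_norml => /andP[? ?] /andP[? ?].
have Ck : 0 <= C * `|k| by rewrite mulr_ge0.
by apply/andP; split; lra.
Unshelve. all: by end_near.
Qed.

Lemma cvg_sinc : sin x / x @[x --> 0^'+] --> (1 : R).
Proof.
apply: cvg_dnbhs_at_right.
have [/= sinD sin'] := is_derive_sin (0 : R).
rewrite -(@cos0 R) -sin' (_ : (fun x : R => sin x / x) =
  fun h : R => h^-1 *: ((sin \o shift 0) h%:A - sin 0)); first exact: sinD.
apply/funext => h /=.
by rewrite -[h%:A]/(h * 1) mulr1 addr0 sin0 subr0 -[_ *: _]/(_ * _) mulrC.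
Qed.

End derivability.

(** * Differentiability on [[-1, 1]] through the substitution [x = cos t] *)

Section cosine_parametrisation.
Context {R : realType}.
Implicit Types F : R -> R.

(** Since [1 - cos t = 2 * sin (t / 2) ^+ 2], the ratio of [1 - cos t] to [t ^+ 2] tends to 1/2,
    kept below in the form [2^-1 * 1 ^+ 2]. *)
Lemma cvg_slope_cos F (b : R) :
    cvg ((F b - F (b * cos t)) / t ^+ 2 @[t --> 0^'+]) ->
  cvg ((F b - F (b * cos t)) / (1 - cos t) @[t --> 0^'+]).
Proof.
move=> /cvg_ex[l /= Fl]; apply/cvg_ex; exists (l * (2^-1 * 1 ^+ 2)^-1).
have half : (t / 2 : R) @[t --> 0^'+] --> (0 : R)^'+.
  move=> A [d /= d0 dA]; exists d => //= t td t0; apply: dA => /=; last exact: divr_gt0.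
  move: td; rewrite /= !sub0r !normrN !gtr0_norm ?divr_gt0// => td.
  by rewrite ltr_pdivrMr//; lra.
have sinc2 : (2^-1 * (sin (t / 2) / (t / 2)) ^+ 2 : R) @[t --> 0^'+] --> (2^-1 * 1 ^+ 2 : R).
  apply: cvgMr; rewrite expr2; apply: cvgM;
    exact: (cvg_comp _ _ half cvg_sinc).
apply: cvg_trans (cvgM Fl (cvgV _ sinc2)); last by rewrite expr1n mulr1 invr_eq0.
apply: near_eq_cvg; near=> t.
have t0 : 0 < t by [].
have tpi : t < pi by near: t; apply: nbhs_right_lt; exact: pi_gt0.
have -> : 1 - cos t = 2 * sin (t / 2) ^+ 2.
  by rewrite [in LHS](splitr t) -mulr2n cos_mulr2n cos2sin2; ring.
rewrite /=; field.
rewrite (gt_eqF t0) gt_eqF// sin_gt0_pi//; lra.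
Unshelve. all: by end_near.
Qed.

(** The condition on [b] treats the end points 1 and -1 together: every [y] of the interval is
    [b * cos t] with [t = acos (b * y)], and [t] tends to 0 as [y] tends to [b]. *)
Lemma cvg_within_endpoint F (b : R) : b ^+ 2 = 1 ->
    cvg ((F b - F (b * cos t)) / (1 - cos t) @[t --> 0^'+]) ->
  cvg ((fun y => (F y - F b) / (y - b)) @ within `[-1, 1] b^').
Proof.
move=> b2 /cvg_ex[l /= Fl]; apply/cvg_ex; exists (b * l); apply/cvgrPdist_le => e e0.
move/cvgrPdist_le : Fl => /(_ _ e0)[d /= d0 hd].
pose d' := Num.min d pi.
have d'0 : 0 < d' by rewrite lt_min d0 pi_gt0.
have d'pi : d' <= pi by rewrite ge_min lexx orbT.
have nb : `|b| = 1 by apply/eqP; rewrite -sqr_norm_eq1; apply/eqP.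
(* As [cos] decreases on [[0, pi]], the distance [1 - cos d'] to [b] corresponds to the angle [d'];
   this is why [d] is cut at [pi]. *)
have cd' : 0 < 1 - cos d'.
  rewrite subr_gt0 -(@cos0 R) ltr_cos ?in_itv/= ?lexx ?pi_ge0//=.
  by rewrite d'pi ltW.
near=> y.
have yI : -1 <= y <= 1 by near: y; exact: withinT.
have yb : y != b.
  by near: y; apply: cvg_within; exists 1 => /=.
have yd : `|b - y| < 1 - cos d'.
  by near: y; apply: cvg_within; exists (1 - cos d') => //= z.
have byI : -1 <= b * y <= 1.
  by rewrite -ler_norml normrM nb mul1r ler_norml.
have bbE z : b * (b * z) = z by rewrite mulrA -expr2 b2 mul1r.
have by1 : b * y < 1.
  case/andP: byI => _; rewrite le_eqVlt => /predU1P[by1|//].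
  by move: yb; rewrite -(bbE y) by1 mulr1 eqxx.
have cosE : cos (acos (b * y)) = b * y by rewrite acosK// in_itv.
have t0 : 0 < acos (b * y) by rewrite acos_gt0//; case/andP: byI => ->.
have td : acos (b * y) < d'.
  rewrite -ltr_cos ?in_itv/= ?acos_ge0 ?acos_lepi ?(ltW d'0)// cosE.
  move: yd; rewrite -(mul1r `|_|) -nb -normrM mulrBr -expr2 b2 => /ltr_normlW; lra.
have := hd (acos (b * y)); rewrite /= sub0r normrN gtr0_norm//.
move=> /(_ (lt_le_trans td _) t0); rewrite ge_min lexx => /(_ isT).
rewrite cosE bbE => h.
rewrite -[leLHS]mul1r -nb -normrM mulrBr bbE.
suff -> : b * ((F y - F b) / (y - b)) = (F b - F y) / (1 - b * y) by [].
have -> : y - b = - b * (1 - b * y) by rewrite mulrBr mulr1 mulNr bbE; ring.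
have b0 : b != 0 by apply: contra_eq_neq b2 => ->; rewrite expr0n eq_sym oner_eq0.
field; rewrite b0 subr_eq0 gt_eqF//.
Unshelve. all: by end_near.
Qed.

(** In the interior, [F] is [(F \o cos) \o acos] with [acos] derivable. At the end points [cos] is
    stationary, so the increments of [F] are compared with [t ^+ 2]. *)
Lemma differentiable_within_cos F :
    (forall t, derivable (F \o cos) t 1) ->
    cvg ((F 1 - F (1 * cos t)) / t ^+ 2 @[t --> 0^'+]) ->
    cvg ((F (-1) - F (-1 * cos t)) / t ^+ 2 @[t --> 0^'+]) ->
  differentiable_within `[-1, 1] F.
Proof.
move=> dF F1 FN1 x /=; rewrite in_itv/= => /andP[].
rewrite le_eqVlt => /predU1P[<-|xN1]; last rewrite le_eqVlt => /predU1P[->|x1].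
- by move=> _; apply/cvg_within_endpoint/cvg_slope_cos => //; rewrite sqrrN expr1n.
- by apply/cvg_within_endpoint/cvg_slope_cos => //; rewrite expr1n.
- have xI : -1 < x < 1 by rewrite xN1.
  have /cvg_ex[l dl] : derivable F x 1.
    apply: (near_eq_derivable (f := (F \o cos) \o acos)).
      near=> y => /=; rewrite acosK// in_itv/=.
      suff : y \in `]-1, 1[ by rewrite in_itv/= => /andP[? ?]; rewrite !ltW.
      by near: y; apply: near_in_itvoo; rewrite in_itv.
    have [] // := is_derive1_comp (derivableP (dF (acos x))) (is_derive1_acos xI).
  apply/cvg_ex; exists l; apply/cvgrPdist_le => e e0.
  move/cvgrPdist_le : dl => /(_ _ e0)[d /= d0 hd].
  near=> y.
  have yx : y != x by near: y; apply: cvg_within; exists 1 => /=.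
  have yd : `|x - y| < d by near: y; apply: cvg_within; exists d.
  have := hd (y - x); rewrite /= sub0r opprB => /(_ yd).
  rewrite subr_eq0 => /(_ yx).
  by rewrite -[_%:A]/((y - x) * 1) mulr1 subrK -[_ *: _]/(_ * _) mulrC.
Unshelve. all: by end_near.
Qed.

End cosine_parametrisation.

(** * Moreau envelopes *)

Section convex_derivative.
Context {R : realType}.
Implicit Types (u : R -> R) (x y : R).

Definition convexR u := forall t x y, 0 <= t <= 1 ->
  u (t * x + (1 - t) * y) <= t * u x + (1 - t) * u y.

Lemma convex_functionR u :
  convex_function (setT : set R^o) u -> convexR u.
Proof.
move=> cu t x y /andP[t0 t1].
by have := cu (Itv01 t0 t1) x y; rewrite !inE => /(_ I I).
Qed.

Lemma convexR_slope u a x b : convexR u -> a < x -> x < b ->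
  (u x - u a) / (x - a) <= (u b - u x) / (b - x).
Proof.
move=> cu ax xb.
have xa0 : 0 < x - a by lra.
have bx0 : 0 < b - x by lra.
have ba0 : 0 < b - a by lra.
rewrite ler_pdivrMr// mulrAC ler_pdivlMr//.
have t01 : 0 <= (b - x) / (b - a) <= 1.
  apply/andP; split; first by rewrite divr_ge0//; lra.
  by rewrite ler_pdivrMr//; lra.
have := cu _ a b t01.
have -> : (b - x) / (b - a) * a + (1 - (b - x) / (b - a)) * b = x.
  by field; rewrite gt_eqF.
rewrite -(ler_pM2r ba0).
have -> : ((b - x) / (b - a) * u a + (1 - (b - x) / (b - a)) * u b) * (b - a) =
    (b - x) * u a + (x - a) * u b.
  by field; rewrite gt_eqF.
lra.
Qed.

(** The supremum of the left difference quotients at [x] serves as slope; every right quotient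
    bounds it. *)
Lemma convexR_subgradient u x : convexR u ->
  exists p, forall y, u x + p * (y - x) <= u y.
Proof.
move=> cu.
pose A := [set (u x - u a) / (x - a) | a in [set a | a < x]].
have hA : has_sup A.
  split; first by exists ((u x - u (x - 1)) / (x - (x - 1))), (x - 1) => //=; lra.
  exists ((u (x + 1) - u x) / (x + 1 - x)) => _ [a /= ax <-].
  by apply: convexR_slope => //; lra.
exists (sup A) => y; have [yx|xy|->] := ltgtP y x.
- have : (u x - u y) / (x - y) <= sup A.
    by apply: sup_upper_bound => //; exists y.
  by rewrite ler_pdivrMr ?subr_gt0//; lra.
- have : sup A <= (u y - u x) / (y - x).
    apply: ge_sup; first by case: hA.
    by move=> _ [a /= ax <-]; exact: convexR_slope.
  by rewrite ler_pdivlMr ?subr_gt0//; lra.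
- by rewrite subrr mulr0 addr0.
Qed.

Lemma is_derive_quadratic_pinch u x p q :
  (forall y, `|u y - u x - p * (y - x)| <= q * (y - x) ^+ 2) -> is_derive x 1 u p.
Proof.
move=> pinch; suff h : h^-1 *: ((u \o shift x) h%:A - u x) @[h --> 0^'] --> p.
  by apply: DeriveDef; [apply/cvg_ex; exists p | exact/cvg_lim].
have q0 : 0 <= q.
  have := pinch (x + 1); have -> : x + 1 - x = 1 by ring.
  by rewrite expr1n !mulr1; apply: le_trans.
apply/cvgrPdist_le => e e0; near=> h.
have h0 : h != 0 by near: h; exact: nbhs_dnbhs_neq.
have he : `|h| < e / (q + 1) by near: h; apply: dnbhs0_lt; rewrite divr_gt0//; lra.
have nh0 : 0 < `|h| by rewrite normr_gt0.
rewrite /= -[h%:A]/(h * 1) mulr1 -[_ *: _]/(_ * _) (addrC h).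
have := pinch (x + h); rewrite (addrC x) addrK => ph.
rewrite -normrN -(ler_pM2r nh0) -normrM.
have -> : - (p - h^-1 * (u (h + x) - u x)) * h = u (h + x) - u x - p * h by field.
apply: (le_trans ph); rewrite -real_normK ?num_real// expr2 mulrA ler_pM2r//.
rewrite ltr_pdivlMr in he; last by lra.
by nra.
Unshelve. all: by end_near.
Qed.

(* Subgradients p of u and r of q x^2 - u satisfy p + r = 2 q x, so both are derivatives. *)
Lemma convexR_smooth u q : convexR u -> convexR (fun x => q * x ^+ 2 - u x) ->
  [/\ forall x y, u x + derive1 u x * (y - x) <= u y,
      forall x y, u y <= u x + derive1 u x * (y - x) + q * (y - x) ^+ 2,
      {homo derive1 u : x y / x <= y} &
      {homo (fun x => 2 * q * x - derive1 u x) : x y / x <= y}].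
Proof.
move=> cu cv.
have sg x : exists p, (forall y, u x + p * (y - x) <= u y) /\
    (forall y, u y <= u x + p * (y - x) + q * (y - x) ^+ 2).
  have [p up] := convexR_subgradient x cu.
  have [r vr] := convexR_subgradient x cv.
  have pr : p + r = 2 * q * x.
    have key s : (p + r - 2 * q * x) * s <= q * s ^+ 2.
      by have := up (x + s); have := vr (x + s); rewrite (addrC x) addrK; lra.
    have q0 : 0 <= q by have := key 1; have := key (-1); lra.
    suff kE : p + r - 2 * q * x = 0 by lra.
    pose k := p + r - 2 * q * x; rewrite -/k.
    (* A linear form [k * s] below [q * s ^+ 2] is zero: at [s = k / (q + 1)] the bound reads
       [(q + 1) * s ^+ 2 <= q * s ^+ 2], whence [s = 0]. *)
    have := key (k / (q + 1)); rewrite -/k.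
    have q10 : 0 < q + 1 by lra.
    have -> : k * (k / (q + 1)) = (q + 1) * (k / (q + 1)) ^+ 2.
      by field; rewrite gt_eqF.
    rewrite mulrDl mul1r => h; have : (k / (q + 1)) ^+ 2 <= 0 by lra.
    rewrite real_exprn_even_le0 ?num_real//= => /eqP.
    by move/eqP; rewrite mulf_eq0 invr_eq0 (gt_eqF q10) orbF => /eqP.
  exists p; split => // y.
  have := vr y; have -> : r = 2 * q * x - p by lra.
  by lra.
have dE x : (forall y, u x + derive1 u x * (y - x) <= u y) /\
    (forall y, u y <= u x + derive1 u x * (y - x) + q * (y - x) ^+ 2).
  have [p [pl pu]] := sg x.
  suff -> : derive1 u x = p by [].
  rewrite derive1E; have [] // : is_derive x 1 u p.
  apply: (@is_derive_quadratic_pinch _ _ _ q) => y.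
  by have := pl y; have := pu y => yu yl; rewrite ger0_norm; lra.
split => [x y|x y|x y xy|x y xy]; [by case: (dE x)|by case: (dE x)| |];
  have [xl xu] := dE x; have [yl yu] := dE y; move: xy;
  rewrite le_eqVlt => /predU1P[->//|xy].
- rewrite -(@ler_pM2r _ (y - x)) ?subr_gt0//.
  by have := xl y; have := yl x; lra.
- rewrite -(@ler_pM2r _ (y - x)) ?subr_gt0//.
  by have := xu y; have := yu x; lra.
Qed.

End convex_derivative.

(** * Convexity and smoothness of the envelope *)

Section moreau_envelope.
Context {R : realType}.
Implicit Types (f : R -> \bar R) (tau x y : R).

(** A cone below [f]. It bounds the infimum in [env] from below, because the quadratic term outgrows
    a linear one, and it excludes the value [-oo]. *)
Definition linear_minorant f := exists x0 A B : R, 0 <= B /\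
  forall y, ((A - B * `|y - x0|)%:E <= f y)%E.

(** Semicontinuity bounds [f] below on a ball around a point [x0] of its domain. For [y] outside,
    convexity is applied at the point where the segment from [x0] to [y] leaves the ball. *)
Lemma pcc_linear_minorant f : proper_closed_convex f -> linear_minorant f.
Proof.
move=> [[fNy [x0 fx0]] lsc cf].
have [r0 fE] : exists r0, f x0 = r0%:E.
  by exists (fine (f x0)); rewrite fineK// fin_numE fNy.
have [V [d /= d0 dV] fV] : exists2 V, nbhs x0 V & forall y, V y -> ((r0 - 1)%:E < f y)%E.
  by apply: lsc; rewrite fE lte_fin; lra.
pose rho := d / 2.
have rho0 : 0 < rho by rewrite divr_gt0.
have near_x0 y : `|y - x0| <= rho -> ((r0 - 1)%:E < f y)%E.
  by move=> h; apply/fV/dV; rewrite /= distrC (le_lt_trans h)// /rho; lra.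
exists x0, (r0 - 1), rho^-1; split=> [|y]; first by rewrite invr_ge0 ltW.
have [yx|yx] := leP `|y - x0| rho.
  apply/ltW/(le_lt_trans _ (near_x0 _ yx)); rewrite lee_fin gerBl.
  by rewrite mulr_ge0// invr_ge0 ltW.
have D0 : 0 < `|y - x0| by exact: lt_trans yx.
pose t := rho / `|y - x0|.
have t0 : 0 < t by rewrite divr_gt0.
have t1 : t < 1 by rewrite ltr_pdivrMr// mul1r.
case fy : (f y) => [s||]; [|by rewrite leey|by have := fNy y; rewrite fy].
have := cf t y x0; rewrite (ltW t0) (ltW t1) => /(_ isT); rewrite fy fE.
have /near_x0 : `|t * y + (1 - t) * x0 - x0| <= rho.
  have -> : t * y + (1 - t) * x0 - x0 = t * (y - x0) by ring.
  by rewrite normrM gtr0_norm// divfK// gt_eqF.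
move=> /lt_le_trans h /h; rewrite -!EFinM -EFinD lte_fin lee_fin => {}h.
have -> : rho^-1 * `|y - x0| = t^-1.
  by rewrite /t; field; rewrite !gt_eqF.
rewrite -(ler_pM2l t0) mulrBr divff ?gt_eqF//; lra.
Qed.

Lemma convexR_linear_minorant (l : R -> R) :
  convexR l -> linear_minorant (EFin \o l).
Proof.
move=> /(convexR_subgradient 0)[p lp]; exists 0, (l 0), `|p|; split => // y.
rewrite lee_fin (le_trans _ (lp y))// lerD2l subr0 -normrM.
by rewrite lerNl -normrN ler_norm.
Qed.

Lemma convexR_econvex (l : R -> R) : convexR l -> econvex (EFin \o l).
Proof. by move=> cl t x y t01; rewrite -!EFinM -EFinD lee_fin cl. Qed.

Section smoothness.
Variables (f : R -> \bar R) (tau : R).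
Hypotheses (tau0 : 0 < tau) (f_fin : exists x, f x != +oo%E).
Hypotheses (f_min : linear_minorant f) (f_cvx : econvex f).

Let q := (2 * tau)^-1.
Let u x := fine (env f tau x).

Let q0 : 0 < q. Proof. by rewrite invr_gt0 mulr_gt0. Qed.

Let fNy y : f y != -oo%E.
Proof.
have [x0 [A [B [_ /(_ y) h]]]] := f_min.
by apply: contraTneq h => ->.
Qed.

Let envE x : env f tau x = (u x)%:E.
Proof.
rewrite /u fineK// fin_numE; apply/andP; split.
  rewrite gt_eqF//; have [x0 [A [B [B0 h]]]] := f_min.
  (* The last term completes the square: [q * r ^+ 2 - B * r] has minimum [- B ^+ 2 / (4 * q)], used
     at [r = |x - y|]. *)
  apply: (@lt_le_trans _ _ (A - B * `|x - x0| - B ^+ 2 / (4 * q))%:E); first exact: ltNyr.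
  apply: le_ereal_inf_tmp => _ [y _ <-].
  apply: (le_trans _ (leeD2r _ (h y))); rewrite -EFinD lee_fin -/q.
  have tri : `|y - x0| <= `|x - x0| + `|x - y|.
    rewrite (_ : y - x0 = (x - x0) - (x - y)); [exact: ler_normB | ring].
  have : B * `|y - x0| <= B * `|x - x0| + B * `|x - y|.
    by rewrite -mulrDr ler_wpM2l.
  rewrite -(@real_normK _ (x - y)) ?num_real//.
  have : 0 <= q * (`|x - y| - B / (2 * q)) ^+ 2.
    by rewrite mulr_ge0 ?sqr_ge0// ltW.
  have -> : q * (`|x - y| - B / (2 * q)) ^+ 2 =
    q * `|x - y| ^+ 2 - B * `|x - y| + B ^+ 2 / (4 * q) by field; rewrite gt_eqF.
  lra.
have [y fy] := f_fin.
rewrite lt_eqF// (@le_lt_trans _ _ (f y + (q * (x - y) ^+ 2)%:E)%E)//.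
  by apply: ereal_inf_lbound; exists y.
have : f y \is a fin_num by rewrite fin_numE fNy.
by move=> /fineK <-; rewrite -EFinD ltry.
Qed.

(** The proofs below handle the infimum only through this bound and [env_ge]; no minimiser is
    constructed. *)
Lemma env_le x y r : f y = r%:E -> u x <= r + q * (x - y) ^+ 2.
Proof.
move=> fy; rewrite -lee_fin -envE EFinD -fy.
by apply: ereal_inf_lbound; exists y.
Qed.

Lemma env_ge x m :
  (forall y r, f y = r%:E -> m <= r + q * (x - y) ^+ 2) -> m <= u x.
Proof.
move=> h; rewrite -lee_fin -envE; apply: le_ereal_inf_tmp => _ [y _ <-].
case fy : (f y) => [r||]; [|by rewrite leey|by have := fNy y; rewrite fy].
by rewrite -EFinD lee_fin h.
Qed.

(** The function [f y + q (x - y)^2] is jointly convex in [(x, y)], and minimising over [y]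
    preserves convexity. *)
Lemma env_convex : convexR u.
Proof.
move=> t x x' /andP[t0 t1].
have key y r y' r' : f y = r%:E -> f y' = r'%:E ->
    u (t * x + (1 - t) * x') <=
    t * (r + q * (x - y) ^+ 2) + (1 - t) * (r' + q * (x' - y') ^+ 2).
  move=> fy fy'; have := f_cvx y y' (introT andP (conj t0 t1)).
  rewrite fy fy' -!EFinM -EFinD.
  case fz : (f _) => [s||]; [|by rewrite leye_eq|]; last first.
    by have := fNy (t * y + (1 - t) * y'); rewrite fz.
  rewrite lee_fin => sle; apply: (le_trans (env_le _ fz)).
  rewrite (le_trans (lerD sle (lexx _)))// -subr_ge0.
  have -> : t * (r + q * (x - y) ^+ 2) + (1 - t) * (r' + q * (x' - y') ^+ 2) -
    (t * r + (1 - t) * r' +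
     q * (t * x + (1 - t) * x' - (t * y + (1 - t) * y')) ^+ 2) =
    q * (t * (1 - t)) * ((x - y) - (x' - y')) ^+ 2 by ring.
  by rewrite mulr_ge0 ?sqr_ge0// mulr_ge0 ?mulr_ge0 ?subr_ge0// ltW.
(* The infimum is taken in [key] over [y], then over [y']. Each passage divides by the weight [t] or
   [1 - t], so the weights 0 and 1 are treated apart. *)
have : u (t * x + (1 - t) * x') - (1 - t) * u x' <= t * u x.
  move: t0; rewrite le_eqVlt => /predU1P[t0|t0].
    by rewrite -t0 !mul0r add0r subr0 !mul1r subrr.
  set G := u (t * x + _); set U' := u x'.
  suff : (G - (1 - t) * U') / t <= u x by rewrite ler_pdivrMr// (mulrC (u x)).
  apply: env_ge => y r fy; rewrite ler_pdivrMr//.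
  move: t1; rewrite le_eqVlt => /predU1P[t1|t1].
    by have := key _ _ _ _ fy fy; rewrite -/G t1; lra.
  have t10 : 0 < 1 - t by lra.
  suff : (G - t * (r + q * (x - y) ^+ 2)) / (1 - t) <= U'.
    by rewrite ler_pdivrMr//; lra.
  apply: env_ge => y' r' fy'; rewrite ler_pdivrMr//.
  by have := key _ _ _ _ fy fy'; rewrite -/G; lra.
lra.
Qed.

(** For fixed [y], [q x^2 - (f y + q (x - y)^2)] is affine in [x], and a supremum of affine
    functions is convex. *)
Lemma env_coconvex : convexR (fun x => q * x ^+ 2 - u x).
Proof.
move=> t x x' /andP[t0 t1].
suff : t * u x + (1 - t) * u x' - q * (t * (1 - t)) * (x - x') ^+ 2 <=
    u (t * x + (1 - t) * x').
  have -> : q * (t * (1 - t)) * (x - x') ^+ 2 =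
    t * (q * x ^+ 2) + (1 - t) * (q * x' ^+ 2) - q * (t * x + (1 - t) * x') ^+ 2.
    by ring.
  lra.
apply: env_ge => y r fy.
have : t * u x <= t * (r + q * (x - y) ^+ 2) by rewrite ler_wpM2l ?env_le.
have : (1 - t) * u x' <= (1 - t) * (r + q * (x' - y) ^+ 2).
  by rewrite ler_wpM2l ?env_le ?subr_ge0.
have -> : q * (t * x + (1 - t) * x' - y) ^+ 2 = t * (q * (x - y) ^+ 2) +
  (1 - t) * (q * (x' - y) ^+ 2) - q * (t * (1 - t)) * (x - x') ^+ 2 by ring.
lra.
Qed.

Let tauq : 2 * q = tau^-1.
Proof. by rewrite /q invfM mulVKf// pnatr_eq0. Qed.

Lemma env'_nondecreasing : {homo env' f tau : x y / x <= y}.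
Proof. by have [] := convexR_smooth env_convex env_coconvex. Qed.

Lemma env'_lipschitz : {homo (fun x => tau^-1 * x - env' f tau x) : x y / x <= y}.
Proof. by have [_ _ _] := convexR_smooth env_convex env_coconvex; rewrite tauq. Qed.

(* x - tau * env' x is the proximal map. Were it constantly y0, u would be q (x - y0)^2 up to
   a constant, and u x <= f y + q (x - y)^2 would fail as x -> oo for y > y0. *)
Lemma prox_nonconstant : (forall y, f y != +oo%E) ->
  exists x y, tau^-1 * x - env' f tau x < tau^-1 * y - env' f tau y.
Proof.
move=> ffin; apply: contrapT => /forallNP h.
have cst x : tau^-1 * x - env' f tau x = - env' f tau 0.
  apply/eqP; rewrite eq_le !leNgt; apply/andP; split; apply/negP => lt.
    by apply: (h 0); exists x; rewrite mulr0 sub0r.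
  by apply: (h x); exists 0; rewrite mulr0 sub0r.
have [_ up _ _] := convexR_smooth env_convex env_coconvex.
pose e := env' f tau 0.
have uE x : derive1 u x = 2 * q * x + e.
  by rewrite tauq -[derive1 u x]/(env' f tau x); have := cst x; rewrite /e; lra.
have ge x : u 0 + e * x + q * x ^+ 2 <= u x by have := up x 0; rewrite uE; lra.
(* Since [2 * q * y = 1 - e], the linear terms of the lower bound [ge] and of the upper bound
   through [y] have slopes differing by 1. They cross at [r + q * y ^+ 2 - u 0], and the next point
   but 1 to the right is contradictory. *)
pose y := (1 - e) / (2 * q).
have [r fy] : exists r, f y = r%:E.
  by exists (fine (f y)); rewrite fineK// fin_numE fNy ffin.
have := env_le (r + q * y ^+ 2 - u 0 + 1) fy.
have := ge (r + q * y ^+ 2 - u 0 + 1).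
set x := (r + _ - _ + _) => h1 h2.
have : 2 * q * y = 1 - e by rewrite /y mulrC divfK// gt_eqF// mulr_gt0.
move: h1 h2; rewrite /x; nra.
Qed.

End smoothness.
End moreau_envelope.

(** * Invariance of the plane Gaussian law *)

Section image_measure.
Context d d' (T : measurableType d) (T' : measurableType d') (R : realType).
Local Open Scope ereal_scope.

Definition image_measure (m : {measure set T -> \bar R}) (f : T -> T')
  (mf : measurable_fun setT f) : {measure set T' -> \bar R}.
Proof. by unshelve refine (pushforward m f : {measure set T' -> \bar R}). Defined.

End image_measure.

(** * The normal density and reflections of the plane *)

Section gaussian_reflection.
Context {R : realType}.
Local Open Scope ereal_scope.
Notation leb := (@lebesgue_measure R).
Notation gamma := (@std_normal R).
Notation pdf := (@normal_pdf R 0 1).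
Notation T := (measurableTypeR R).

(** [a] times the image of Lebesgue measure under the affine map gives each half-open interval its
    length, and this characterises Lebesgue measure. *)
Lemma ge0_integral_affine (a b : R) (f : measurableTypeR R -> \bar R) : (0 < a)%R ->
    measurable_fun setT f -> (forall x, 0 <= f x) ->
  \int[leb]_x (f (a * x + b)%R * a%:E) = \int[leb]_x f x.
Proof.
move=> a0 mf f0.
have mphi : measurable_fun setT (fun x : measurableTypeR R => (a * x + b)%R : measurableTypeR R).
  by apply: measurable_funD => //; exact: measurable_funM.
pose k : {nonneg R} := NngNum (ltW a0).
pose m : {measure set (measurableTypeR R) -> \bar R} :=
  mscale k (image_measure leb mphi).
have lebE (A : set (measurableTypeR R)) : measurable A -> leb A = m A.
  move=> mA; apply: (lebesgue_measure_unique (mu := m)) mA => _ [[c d] _ <-] /=.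
  rewrite /m /mscale /= /image_measure /pushforward/=.
  have -> : (fun x : R => a * x + b)%R @^-1` `]c, d] = `]((c - b) / a)%R, ((d - b) / a)%R]%classic.
    apply/seteqP; split => x /=; rewrite !in_itv/= ltr_pdivrMr// ler_pdivlMr//;
      by rewrite ltrBlDr lerBrDr (mulrC x).
  rewrite !lebesgue_measure_itv/= !lte_fin ltr_pM2r ?invr_gt0// ltrD2r.
  case: ifPn => // _; last by rewrite mule0.
  by rewrite -!EFinD -EFinM; congr (_%:E); field; rewrite gt_eqF.
rewrite [RHS](eq_measure_integral m).
  rewrite /m ge0_integral_mscale//= /image_measure/= ge0_integral_pushforward// preimage_setT.
  rewrite muleC -ge0_integralZr//.
  + exact: measurableT_comp.
  + by move=> x _; exact: f0.
  + by rewrite lee_fin ltW.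
by move=> A mA _; exact: lebE.
Qed.

(** The Radon-Nikodym derivative of the normal law agrees almost everywhere with the density, as
    both have the same integral over every measurable set. *)
Lemma ge0_integral_std_normal (f : measurableTypeR R -> \bar R) :
    measurable_fun setT f -> (forall x, 0 <= f x) ->
  \int[gamma]_x f x = \int[leb]_x (f x * (pdf x)%:E).
Proof.
move=> mf f0.
have dom := normal_prob_dominates (0 : R) 1.
rewrite -(Radon_Nikodym_SigmaFinite.change_of_variables dom)//.
apply: ae_eq_integral => //.
- apply: emeasurable_funM => //.
  exact: measurable_int (Radon_Nikodym_SigmaFinite.f_integrable _).
- apply: emeasurable_funM => //.
  by apply/measurable_EFinP; exact: measurable_normal_pdf.
- apply: ae_eqe_mul2l; apply: integral_ae_eq => //.
  + exact: Radon_Nikodym_SigmaFinite.f_integrable.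
  + by apply/measurable_EFinP; exact: measurable_normal_pdf.
  + by move=> A _ mA; rewrite -Radon_Nikodym_SigmaFinite.f_integral.
Qed.

Let mpdf (d : measure_display) (U : measurableType d) (h : U -> T) :
  measurable_fun setT h -> measurable_fun setT (fun x => (pdf (h x))%:E).
Proof.
move=> mh; apply/measurable_EFinP; apply: measurableT_comp mh.
exact: measurable_normal_pdf.
Qed.

Lemma ge0_integral_std_normal2 (F : T * T -> \bar R) :
    measurable_fun setT F -> (forall p, 0 <= F p) ->
  \int[gamma \x gamma]_p F p =
  \int[leb]_x \int[leb]_w (F (x, w) * (pdf x * pdf w)%:E).
Proof.
move=> mF F0; rewrite fubini_tonelli1//.
have mFx x : measurable_fun setT (fun w => F (x, w)) by exact: measurableT_comp.
rewrite ge0_integral_std_normal; last 2 first.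
- exact: measurable_fun_fubini_tonelli_F.
- by move=> x; apply: integral_ge0.
apply: eq_integral => x _; rewrite /fubini_F.
rewrite ge0_integral_std_normal// -ge0_integralZr//.
- by apply: eq_integral => w _; rewrite -muleA -EFinM (mulrC (pdf x)).
- by apply: emeasurable_funM => //; exact: mpdf.
- by move=> w _; rewrite mule_ge0// lee_fin normal_pdf_ge0.
- by rewrite lee_fin normal_pdf_ge0.
Qed.

(** The product density depends only on [x ^+ 2 + w ^+ 2], which the reflection preserves. *)
Lemma normal_pdf_reflection (a b x w : R) : (a ^+ 2 + b ^+ 2 = 1)%R ->
  (pdf (a * x + b * w) * pdf (b * x - a * w) = pdf x * pdf w)%R.
Proof.
move=> ab.
have pdfE z : pdf z = (normal_peak 1 * expR (- z ^+ 2 / 2))%R.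
  by rewrite /normal_pdf oner_eq0 /normal_fun subr0 expr1n.
rewrite !pdfE; set k := normal_peak 1.
suff e : (expR (- (a * x + b * w) ^+ 2 / 2) * expR (- (b * x - a * w) ^+ 2 / 2) =
  expR (- x ^+ 2 / 2) * expR (- w ^+ 2 / 2))%R.
  by rewrite mulrACA e mulrACA.
rewrite -!expRD; congr expR.
transitivity (- ((a ^+ 2 + b ^+ 2) * (x ^+ 2 + w ^+ 2)) / 2)%R; first by ring.
by rewrite ab; ring.
Qed.
(* The substitutions u = a x + b w in w, then v = (x - a u) / b in x, both affine. *)
Lemma ge0_integral_reflection (a b : R) (F : T * T -> \bar R) :
    (a ^+ 2 + b ^+ 2 = 1)%R -> (0 < b)%R ->
    measurable_fun setT F -> (forall p, 0 <= F p) ->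
  \int[gamma \x gamma]_p F ((a * p.1 + b * p.2)%R, (b * p.1 - a * p.2)%R) =
  \int[gamma \x gamma]_p F p.
Proof.
move=> ab b0 mF F0.
have bN0 : b != 0%R by rewrite gt_eqF.
have b1 : (a ^+ 2 = 1 - b ^+ 2)%R by rewrite -ab addrK.
pose K (p : T * T) := F p * (pdf p.1 * pdf p.2)%:E.
have K0 p : 0 <= K p by rewrite mule_ge0// lee_fin mulr_ge0// normal_pdf_ge0.
have mK : measurable_fun setT K.
  by apply: emeasurable_funM => //; rewrite /=; under eq_fun do rewrite EFinM;
    apply: emeasurable_funM; exact: mpdf.
have mS : measurable_fun setT (fun p : T * T =>
    F ((a * p.1 + b * p.2)%R, (b * p.1 - a * p.2)%R)).
  apply: (measurableT_comp mF); apply/measurable_fun_pair => /=;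
    [apply: measurable_funD|apply: measurable_funB]; exact: measurable_funM.
rewrite (ge0_integral_std_normal2 mF F0).
rewrite (ge0_integral_std_normal2 mS (fun p => F0 _)).
transitivity (\int[leb]_x \int[leb]_u (K (u, ((x - a * u) / b)%R) * b^-1%:E)).
  apply: eq_integral => x _.
  rewrite -[RHS](@ge0_integral_affine b (a * x))//; last 2 first.
  - apply: emeasurable_funM => //; apply: measurableT_comp => //.
    apply/measurable_fun_pair => //=; apply: measurable_funM => //.
    by apply: measurable_funB => //; exact: measurable_funM.
  - by move=> u; rewrite mule_ge0// lee_fin invr_ge0 ltW.
  apply: eq_integral => w _.
  rewrite -muleA -EFinM mulVf// mule1 /K /=.
  have -> : ((x - a * (b * w + a * x)) / b = b * x - a * w)%R.
    have -> : (x - a * (b * w + a * x) = x - a * b * w - a ^+ 2 * x)%R by ring.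
    by rewrite b1; field.
  by rewrite (addrC (b * w)%R) (normal_pdf_reflection x w ab).
rewrite (fubini_tonelli (m1 := leb) (m2 := leb)
  (fun q : T * T => K (q.2, ((q.1 - a * q.2) / b)%R) * b^-1%:E)); last 2 first.
- apply: emeasurable_funM => //; apply: measurableT_comp => //.
  apply/measurable_fun_pair => //=; apply: measurable_funM => //.
  by apply: measurable_funB => //; exact: measurable_funM.
- by move=> q; rewrite mule_ge0// lee_fin invr_ge0 ltW.
apply: eq_integral => u _ /=.
transitivity (\int[leb]_v K (u, v)) => //.
have mKu : measurable_fun setT (fun v : T => K (u, v)) by exact: (measurableT_comp mK).
have bV0 : (0 < b^-1)%R by rewrite invr_gt0.
rewrite -(ge0_integral_affine (- (a * u / b)) bV0 mKu (fun v => K0 (u, v))).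
apply: eq_integral => x _; congr (K (u, _) * _).
by rewrite mulrBl (mulrC b^-1%R).
Qed.

End gaussian_reflection.

(** * Images of measures *)

Section transport.
Context d1 d2 (U1 : measurableType d1) (U2 : measurableType d2) (R : realType).
Local Open Scope ereal_scope.

(** Says that [m2] is the image of [m1] under [T]. Testing on nonnegative functions fits Tonelli,
    hence products, and needs no integrability; signed integrals follow. *)
Definition transports (m1 : set U1 -> \bar R) (T : U1 -> U2)
    (m2 : set U2 -> \bar R) :=
  measurable_fun setT T /\
  forall f, measurable_fun setT f -> (forall x, 0 <= f x) ->
    \int[m2]_x f x = \int[m1]_x f (T x).

Lemma transports_integral (m1 : {measure set U1 -> \bar R}) T
    (m2 : {measure set U2 -> \bar R}) (f : U2 -> \bar R) : transports m1 T m2 ->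
  measurable_fun setT f -> \int[m2]_x f x = \int[m1]_x f (T x).
Proof.
move=> [mT h] mf; rewrite integralE [RHS](@integralE _ _ _ _ _ (f \o T)).
rewrite (funepos_comp f T) (funeneg_comp f T) !h//.
- exact: measurable_funeneg.
- exact: measurable_funepos.
Qed.

Lemma transports_integrable (m1 : {measure set U1 -> \bar R}) T
    (m2 : {measure set U2 -> \bar R}) (f : U2 -> \bar R) :
    transports m1 T m2 -> measurable_fun setT f ->
  m2.-integrable setT f -> m1.-integrable setT (f \o T).
Proof.
move=> [mT h] mf /integrableP[_ fi]; apply/integrableP; split.
  exact: measurableT_comp.
suff <- : \int[m2]_x `|f x| = \int[m1]_x `|(f \o T) x| by [].
by apply: (h (abse \o f)) => [|x]; [exact: measurableT_comp|exact: abse_ge0].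
Qed.

End transport.

Section transport_comp.
Context d1 d2 d3 (U1 : measurableType d1) (U2 : measurableType d2)
  (U3 : measurableType d3) (R : realType).
Local Open Scope ereal_scope.

Lemma transports_comp (m1 : set U1 -> \bar R) T (m2 : set U2 -> \bar R) T'
    (m3 : set U3 -> \bar R) :
  transports m1 T m2 -> transports m2 T' m3 -> transports m1 (T' \o T) m3.
Proof.
move=> [mT h] [mT' h']; split; first exact: measurableT_comp.
move=> f mf f0; rewrite h'//; apply: (h (f \o T')) => [|x]; last exact: f0.
exact: measurableT_comp.
Qed.

Lemma transports_prod (P : {sigma_finite_measure set U1 -> \bar R})
    (m2 : {sigma_finite_measure set U2 -> \bar R}) T
    (m3 : {sigma_finite_measure set U3 -> \bar R}) :
  transports m2 T m3 ->
  transports (P \x m2) (fun x => (x.1, T x.2)) (P \x m3).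
Proof.
move=> [mT h].
have mT' : measurable_fun [set: U1 * U2] (fun x => (x.1, T x.2)).
  by apply/measurable_fun_pair => //=; exact: measurableT_comp.
split => // f mf f0.
rewrite fubini_tonelli1//.
rewrite (fubini_tonelli1 (fun x => f (x.1, T x.2)))//; last first.
  exact: (measurableT_comp mf mT').
apply: eq_integral => x _; rewrite /fubini_F/=.
by apply: (h (fun y => f (x, y))) => //; exact: measurableT_comp.
Qed.

Lemma transports_fst (m1 : {sigma_finite_measure set U1 -> \bar R})
    (P : probability U2 R) :
  transports (m1 \x P) fst m1.
Proof.
split; first exact: measurable_fst.
move=> f mf f0; have mf1 : measurable_fun [set: U1 * U2] (f \o fst).
  exact: measurableT_comp.
rewrite (fubini_tonelli1 _ mf1 (fun x => f0 _)).
apply: eq_integral => x _; rewrite /fubini_F/=.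
rewrite integral_cst// [X in _ * X](_ : _ = 1) ?mule1//.
exact: (probability_setT P).
Qed.

Lemma transports_snd (P : probability U1 R)
    (m2 : {sigma_finite_measure set U2 -> \bar R}) :
  transports (P \x m2) snd m2.
Proof.
split; first exact: measurable_snd.
move=> f mf f0; have mf2 : measurable_fun [set: U1 * U2] (f \o snd).
  exact: measurableT_comp.
rewrite (fubini_tonelli2 _ mf2 (fun x => f0 _)).
apply: eq_integral => x _; rewrite /fubini_G/=.
rewrite integral_cst// [X in _ * X](_ : _ = 1) ?mule1//.
exact: (probability_setT P).
Qed.

End transport_comp.

(** * Rotations of the plane Gaussian law *)

Section gaussian_rotation.
Context {R : realType}.
Local Open Scope ereal_scope.
Notation gamma := (@std_normal R).
Notation T := (measurableTypeR R).

Definition gauss_proj (t : R) (p : T * T) : T := (cos t * p.1 + sin t * p.2)%R.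

Lemma measurable_gauss_proj t : measurable_fun setT (gauss_proj t).
Proof. by apply: measurable_funD; apply: measurable_funM. Qed.

Definition gauss_pair (s t : R) (p : T * T) : T * T :=
  (gauss_proj s p, gauss_proj t p).

Lemma measurable_gauss_pair s t : measurable_fun setT (gauss_pair s t).
Proof. by apply/measurable_fun_pair; exact: measurable_gauss_proj. Qed.

Definition gauss2 : probability (T * T)%type R := (gamma \x gamma)%E.

Let I (F : T * T -> \bar R) s t := \int[gamma \x gamma]_p F (gauss_pair s t p).

(** The reflection in the line of angle [r / 2] turns the direction [s] into [r - s]; the range of
    [r] makes [sin r] positive. *)
Let reflect F r s t : measurable_fun setT F -> (forall p, 0 <= F p) ->
  (0 < r < pi)%R -> I F s t = I F (r - s) (r - t).
Proof.
move=> mF F0 rpi; have := @ge0_integral_reflection R (cos r) (sin r)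
  (F \o gauss_pair s t) (cos2Dsin2 r) (sin_gt0_pi rpi).
rewrite /I => <- //=; last exact: (measurableT_comp mF (measurable_gauss_pair s t)).
apply: eq_integral => p _; congr F; congr pair; rewrite /gauss_proj/= cosB sinB;
  ring.
Qed.

(* A rotation by less than pi is a product of two reflections; iterate for the others. *)
Let shift F x s t : measurable_fun setT F -> (forall p, 0 <= F p) ->
  I F s t = I F (x + s) (x + t).
Proof.
move=> mF F0; have [n xn] : exists n : nat, (`|x| < n%:R * pi)%R.
  exists (Num.truncn (`|x| / pi)).+1; rewrite -ltr_pdivrMr ?pi_gt0//.
  exact: truncnS_gt.
elim: n x s t xn => [|n IH] x s t; first by rewrite mul0r ltNge normr_ge0.
rewrite -natr1 mulrDl mul1r => xn.
have shift1 y s' t' : (`|y| < pi)%R -> I F s' t' = I F (y + s') (y + t').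
  (* The rotation by [y] is the reflection with parameter [(pi - y) / 2] followed by the one with
     parameter [(pi + y) / 2]; both lie in []0, pi[]. *)
  move=> ypi; have y2 : (0 < (pi + y) / 2 < pi)%R by move: ypi; rewrite ltr_norml; lra.
  have y2' : (0 < (pi - y) / 2 < pi)%R by move: ypi; rewrite ltr_norml; lra.
  rewrite (reflect _ _ mF F0 y2') (reflect _ _ mF F0 y2).
  by congr (I F _ _); field.
have [n0|n0] := posnP n.
  by apply: shift1; rewrite n0 mul0r add0r in xn.
have n1 : (0 < n%:R + 1 :> R)%R by rewrite ltr_wpDl.
have nn : (0 < n%:R :> R)%R by rewrite ltr0n.
(* The angle [x] is split into [n * x / (n + 1)], smaller than [n * pi], and [x / (n + 1)], smaller
   than [pi]. For [n = 0] the first bound would fail, hence the separate case. *)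
rewrite (IH (n%:R * (x / (n%:R + 1)))%R); last first.
  rewrite normrM ger0_norm// ltr_pM2l// normrM normfV (gtr0_norm n1) ltr_pdivrMr//.
  by rewrite mulrDr mulr1 (mulrC pi).
rewrite (shift1 (x / (n%:R + 1)))%R; last first.
  rewrite normrM normfV (gtr0_norm n1) ltr_pdivrMr//.
  by rewrite mulrDr mulr1 (mulrC pi).
by congr (I F _ _); field; rewrite gt_eqF.
Qed.

(** A rotation moves one angle to 0. The square root in [correlate] is the absolute value of a sine,
    so the sign of [sin (s - t)] decides whether a reflection is also needed. *)
Lemma transports_gauss_pair s t :
  transports gauss2 (gauss_pair s t) (bigauss (cos (s - t))).
Proof.
split; first exact: measurable_gauss_pair.
move=> F mF F0; apply: (etrans (ge0_integral_distribution _ mF F0)) => /=.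
rewrite -[RHS]/(I F s t).
have corrE r : (0 <= sin r)%R -> correlate (cos r) = gauss_pair 0 r.
  move=> sr; apply/funext => p; rewrite /correlate /gauss_pair /gauss_proj.
  by rewrite cos0 sin0 mul1r mul0r addr0 -sin2cos2 sqrtr_sqr ger0_norm.
have [st|st] := leP 0%R (sin (s - t)).
  rewrite corrE//.
  have hpi : (0 < (pi : R) / 2 < pi)%R by have := @pi_gt0 R; lra.
  rewrite (reflect _ _ mF F0 hpi) (shift (s - pi / 2)%R _ _ mF F0).
  rewrite -[LHS]/(I F 0%R (s - t)%R).
  by congr (I F _ _); ring.
rewrite -cosN corrE ?sinN ?oppr_ge0 ?(ltW st)//.
rewrite (shift (- s)%R _ _ mF F0).
rewrite -[LHS]/(I F 0%R (- (s - t))%R).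
by congr (I F _ _); ring.
Qed.

Lemma transports_gauss_proj t : transports gauss2 (gauss_proj t) gamma.
Proof.
suff h : transports (bigauss (cos (t - t))) fst gamma.
  exact: (transports_comp (transports_gauss_pair t t) h).
split; first exact: measurable_fst.
move=> F mF F0; have [_ h] := @transports_fst _ _ _ _ R gamma gamma.
have mF1 : measurable_fun [set: T * T] (F \o fst).
  exact: (measurableT_comp mF measurable_fst).
rewrite (h F mF F0); apply/esym.
exact: (ge0_integral_distribution _ mF1 (fun x => F0 _)).
Qed.

End gaussian_rotation.

(** * Second moment of the standard normal law *)

Section gaussian_moment.
Context {R : realType}.
Local Open Scope ereal_scope.
Notation T := (measurableTypeR R).

(** Comparison with the normal law of variance 2: [1 + u <= expR u] at [u = x^2 / 4] gives
    [x^2 exp (- x^2 / 2) <= 4 exp (- x^2 / 4)]. The constant [C] adjusts the normalisations. *)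
Lemma std_normal_sqr_lty : \int[@std_normal R]_x (x ^+ 2)%:E < +oo.
Proof.
rewrite ge0_integral_std_normal//; last 2 first.
- by apply/measurable_EFinP; exact: measurable_funX.
- by move=> x; rewrite lee_fin sqr_ge0.
pose s2 : R := Num.sqrt 2.
have s20 : s2 != 0%R by rewrite gt_eqF// sqrtr_gt0.
pose C : R := (4 * normal_peak 1 / normal_peak s2)%R.
have pk : (0 < normal_peak s2)%R by exact: normal_peak_gt0.
have pk1 : (0 < normal_peak (1 : R))%R by apply: normal_peak_gt0; exact: oner_neq0.
have C0 : (0 <= C)%R by rewrite /C divr_ge0 ?mulr_ge0// ltW.
have mpdf (s : R) : measurable_fun [set: T] (fun x : T => (normal_pdf 0 s x)%:E).
  by apply/measurable_EFinP; exact: measurable_normal_pdf.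
apply: (@le_lt_trans _ _ (\int[lebesgue_measure]_x (C%:E * (normal_pdf 0 s2 x)%:E))).
  apply: ge0_le_integral => //.
  - by move=> x _; rewrite mule_ge0 ?lee_fin ?sqr_ge0// normal_pdf_ge0.
  - apply: emeasurable_funM; last exact: mpdf.
    by apply/measurable_EFinP; exact: measurable_funX.
  - by apply: emeasurable_funM; [exact: measurable_cst|exact: mpdf].
  - move=> x _; rewrite -!EFinM lee_fin.
    have pdfE : normal_pdf 0 1 x = (normal_peak 1 * expR (- x ^+ 2 / 2))%R.
      by rewrite /normal_pdf oner_eq0 /normal_fun subr0 expr1n.
    have pdf2E : normal_pdf 0 s2 x = (normal_peak s2 * expR (- x ^+ 2 / 4))%R.
      rewrite /normal_pdf (negbTE s20) /normal_fun subr0 sqr_sqrtr//.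
      by congr (_ * expR (_ / _))%R; ring.
    rewrite pdfE pdf2E /C.
    have -> : (4 * normal_peak 1 / normal_peak s2 * (normal_peak s2 * expR (- x ^+ 2 / 4)) =
      normal_peak 1 * (4 * expR (- x ^+ 2 / 4)))%R by field; rewrite gt_eqF.
    rewrite mulrCA ler_pM2l//.
    have -> : (- x ^+ 2 / 2 = - x ^+ 2 / 4 + - x ^+ 2 / 4)%R by field.
    rewrite expRD mulrA ler_pM2r ?expR_gt0//.
    have := expR_ge1Dx (x ^+ 2 / 4)%R.
    have e1 : (expR (x ^+ 2 / 4) * expR (- x ^+ 2 / 4) = 1)%R.
      by rewrite -expRD mulNr addrN expR0.
    have e0 := expR_gt0 (- x ^+ 2 / 4)%R.
    nra.
rewrite ge0_integralZl//.
- by rewrite integral_normal_pdf mule1 ltry.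
- by move=> x _; rewrite lee_fin normal_pdf_ge0.
Qed.

End gaussian_moment.

(** * Correlations of Gaussian functions *)

Section square_integrable.
Context d (T : measurableType d) (R : realType) (m : {measure set T -> \bar R}).
Implicit Types X Y V W : T -> R.

Definition sqint X :=
  measurable_fun setT X /\ m.-integrable setT (fun x => (X x ^+ 2)%:E).

Definition ip X Y := \int[m]_x (X x * Y x).

Lemma sqint_le X Y : measurable_fun setT X -> sqint Y ->
  (forall x, X x ^+ 2 <= Y x ^+ 2) -> sqint X.
Proof.
move=> mX [mY iY] XY; split => //.
apply: (le_integrable _ _ _ iY) => //.
- by apply/measurable_EFinP; exact: measurable_funX.
- by move=> x _; rewrite lee_fin !ger0_norm ?sqr_ge0.
Qed.

Lemma sqintZ c X : sqint X -> sqint (fun x => c * X x).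
Proof.
move=> [mX iX]; split; first exact: measurable_funM.
rewrite (_ : (fun x => _) = (fun x => ((c ^+ 2)%:E * (X x ^+ 2)%:E)%E)).
  exact: integrableZl.
by apply/funext => x; rewrite -EFinM exprMn.
Qed.

Lemma sqintD X Y : sqint X -> sqint Y -> sqint (fun x => X x + Y x).
Proof.
move=> [mX iX] [mY iY]; split; first exact: measurable_funD.
have i2 : m.-integrable setT (fun x => (2%:E * (X x ^+ 2)%:E + 2%:E * (Y x ^+ 2)%:E)%E).
  by apply: integrableD => //; exact: integrableZl.
apply: (le_integrable _ _ _ i2) => //.
- by apply/measurable_EFinP; apply: measurable_funX; exact: measurable_funD.
- move=> x _; rewrite -!EFinM -EFinD lee_fin ger0_norm ?sqr_ge0//.
  have X0 := sqr_ge0 (X x); have Y0 := sqr_ge0 (Y x).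
  rewrite ger0_norm; last lra.
  by have := sqr_ge0 (X x - Y x); lra.
Qed.

Lemma sqintB X Y : sqint X -> sqint Y -> sqint (fun x => X x - Y x).
Proof.
move=> sX sY; rewrite (_ : (fun x => _) = (fun x => X x + -1 * Y x)).
  by apply: sqintD => //; exact: sqintZ.
by apply/funext => x; rewrite mulN1r.
Qed.

Lemma sqint_norm X : sqint X -> sqint (fun x => `|X x|).
Proof.
move=> sX; apply: (sqint_le _ sX) => [|x]; last by rewrite real_normK ?num_real.
by have [mX _] := sX; exact: measurableT_comp.
Qed.

Lemma sqint_mul_integrable X Y : sqint X -> sqint Y ->
  m.-integrable setT (EFin \o (fun x => X x * Y x)).
Proof.
move=> [mX iX] [mY iY].
apply: (le_integrable _ _ _ (integrableD measurableT iX iY)) => //.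
- by apply/measurable_EFinP; exact: measurable_funM.
- move=> x _ /=; rewrite lee_fin.
  rewrite [leRHS]ger0_norm; last by rewrite addr_ge0 ?sqr_ge0.
  rewrite normrM -(real_normK (num_real (X x))) -(real_normK (num_real (Y x))).
  have := sqr_ge0 (`|X x| - `|Y x|); have := normr_ge0 (X x); have := normr_ge0 (Y x).
  nra.
Qed.

Lemma ipC X Y : ip X Y = ip Y X.
Proof. by apply: eq_Rintegral => x _; rewrite mulrC. Qed.

Lemma ipDl X Y Z : sqint X -> sqint Y -> sqint Z ->
  ip (fun x => X x + Y x) Z = ip X Z + ip Y Z.
Proof.
move=> sX sY sZ; rewrite -RintegralD//; [|exact: sqint_mul_integrable..].
by apply: eq_Rintegral => x _; rewrite mulrDl.
Qed.

Lemma ipZl c X Y : sqint X -> sqint Y -> ip (fun x => c * X x) Y = c * ip X Y.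
Proof.
move=> sX sY; rewrite -RintegralZl//; last exact: sqint_mul_integrable.
by apply: eq_Rintegral => x _; rewrite mulrA.
Qed.

Lemma ipBl X Y Z : sqint X -> sqint Y -> sqint Z ->
  ip (fun x => X x - Y x) Z = ip X Z - ip Y Z.
Proof.
move=> sX sY sZ; rewrite -RintegralB//; [|exact: sqint_mul_integrable..].
by apply: eq_Rintegral => x _; rewrite mulrBl.
Qed.

Lemma ipDr X Y Z : sqint X -> sqint Y -> sqint Z ->
  ip Z (fun x => X x + Y x) = ip Z X + ip Z Y.
Proof. by move=> *; rewrite ipC ipDl// !(ipC Z). Qed.

Lemma ipBr X Y Z : sqint X -> sqint Y -> sqint Z ->
  ip Z (fun x => X x - Y x) = ip Z X - ip Z Y.
Proof. by move=> *; rewrite ipC ipBl// !(ipC Z). Qed.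

Lemma ipZr c X Y : sqint X -> sqint Y -> ip Y (fun x => c * X x) = c * ip Y X.
Proof. by move=> *; rewrite ipC ipZl// (ipC Y). Qed.

Lemma ip_ge0 X Y : (forall x, 0 <= X x * Y x) -> 0 <= ip X Y.
Proof. by move=> h; apply: Rintegral_ge0. Qed.

Lemma ipxx_ge0 X : 0 <= ip X X.
Proof. by apply: ip_ge0 => x; rewrite -expr2 sqr_ge0. Qed.

Lemma norm_ip_le c X Y V W : sqint X -> sqint Y -> sqint V -> sqint W ->
  (forall x, `|X x * Y x| <= c * (V x * W x)) -> `|ip X Y| <= c * ip V W.
Proof.
move=> sX sY sV sW h; rewrite /ip.
have iXY := sqint_mul_integrable sX sY.
have iVW := sqint_mul_integrable sV sW.
rewrite (le_trans (le_normr_Rintegral _ _))// -RintegralZl//.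
apply: le_Rintegral => //.
  by apply: (integrable_abse (f := EFin \o _)).
by rewrite [X in m.-integrable _ X](_ : _ = (fun x => c%:E * (V x * W x)%:E)%E); [exact: integrableZl|].
Qed.

(** The squared norm of [X - t Y] is a nonnegative polynomial in [t], evaluated at its minimiser
    when [ip Y Y] is positive. *)
Lemma ip_cauchy_schwarz X Y : sqint X -> sqint Y ->
  ip X Y ^+ 2 <= ip X X * ip Y Y.
Proof.
move=> sX sY.
have h t : 0 <= ip X X - 2 * t * ip X Y + t ^+ 2 * ip Y Y.
  have sZ := sqintZ t sY.
  have := ipxx_ge0 (fun x => X x - t * Y x).
  rewrite ipBl ?ipBr ?ipZl ?ipZr//; [|exact: sqintB..].
  by rewrite (ipC Y X); lra.
have := ipxx_ge0 Y; rewrite le_eqVlt => /predU1P[Y0|Y0]; last first.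
  have := h (ip X Y / ip Y Y).
  have -> : ip X X - 2 * (ip X Y / ip Y Y) * ip X Y + (ip X Y / ip Y Y) ^+ 2 * ip Y Y =
    (ip X X * ip Y Y - ip X Y ^+ 2) / ip Y Y by field; rewrite gt_eqF.
  by rewrite pmulr_lge0 ?invr_gt0// subr_ge0.
rewrite -Y0 mulr0; have X0 := ipxx_ge0 X.
suff -> : ip X Y = 0 by rewrite expr0n.
apply/eqP; apply: contraT => XY0.
(* With [ip Y Y = 0] the polynomial is affine in [t], and this [t] gives it the value -1. *)
have := h ((ip X X + 1) / (2 * ip X Y)); rewrite -Y0 mulr0 addr0.
have -> : 2 * ((ip X X + 1) / (2 * ip X Y)) * ip X Y = ip X X + 1 by field.
lra.
Qed.

Lemma ip_minkowski X Y : sqint X -> sqint Y ->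
  Num.sqrt (ip (fun x => X x + Y x) (fun x => X x + Y x)) <=
  Num.sqrt (ip X X) + Num.sqrt (ip Y Y).
Proof.
move=> sX sY; have X0 := ipxx_ge0 X; have Y0 := ipxx_ge0 Y.
rewrite -[leRHS]ger0_norm ?addr_ge0 ?sqrtr_ge0// -sqrtr_sqr ler_wsqrtr//.
rewrite sqrrD !sqr_sqrtr//.
rewrite ipDl ?ipDr//; last exact: sqintD.
rewrite (ipC Y X) -sqrtrM//.
have : ip X Y <= Num.sqrt (ip X X * ip Y Y).
  by rewrite (le_trans (ler_norm _))// -sqrtr_sqr ler_wsqrtr// ip_cauchy_schwarz.
rewrite mulr2n; lra.
Qed.

End square_integrable.

(** * Lipschitz bounds for sine and cosine *)

Section trigonometric_lipschitz.
Context {R : realType}.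

Lemma derivable1_lipschitz (f f' : R -> R) :
    (forall x : R, is_derive x 1 f (f' x)) -> (forall x, `|f' x| <= 1) ->
  forall x y, `|f x - f y| <= `|x - y|.
Proof.
move=> df f'1.
have wlog_le x y : x < y -> `|f y - f x| <= `|y - x|.
  move=> xy; have cf : {within `[x, y], continuous f}.
    by apply: derivable_within_continuous => z _; have [] := df z.
  have [c _ ->] := MVT xy (fun x _ => df x) cf.
  by rewrite normrM ler_piMl.
move=> x y; have [xy|xy|->] := ltgtP x y; last by rewrite !subrr !normr0.
- by rewrite distrC (distrC x) wlog_le.
- exact: wlog_le.
Qed.

Lemma cos_lipschitz (x y : R) : `|cos x - cos y| <= `|x - y|.
Proof.
apply: (derivable1_lipschitz (f' := fun x => - sin x)) => z.
by rewrite normrN ler_norml sin_geN1 sin_le1.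
Qed.

Lemma sin_lipschitz (x y : R) : `|sin x - sin y| <= `|x - y|.
Proof.
apply: (derivable1_lipschitz (f' := cos)) => z.
by rewrite ler_norml cos_geN1 cos_le1.
Qed.

End trigonometric_lipschitz.

(** * The process [f(N_t)] and its correlation function *)

Section correlation.
Context d (Z : measurableType d) (R : realType) (P : probability Z R).
Notation gamma := (@std_normal R).
Notation T := (measurableTypeR R).
Notation mu := (P \x @gauss2 R)%E.
Implicit Types f g h : Z -> R -> R.

Record lipscore (L : R) f := LipScore {
  lipscore_sqint : sqint (P \x gamma)%E (fun w : Z * T => f w.1 w.2) ;
  lipscore_lip : forall z a b, `|f z a - f z b| <= L * `|a - b| }.

(** This is B(eta) with an additional variable of law [P], independent of the Gaussian pair and
    common to both functions. *)
Definition corr f g (eta : R) : R :=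
  fine (\int[P \x bigauss eta]_w (f w.1 w.2.1 * g w.1 w.2.2)%:E).

Definition process f (t : R) (w : Z * (T * T)) : R := f w.1 (gauss_proj t w.2).

Lemma sqint_process L f t : lipscore L f -> sqint mu (process f t).
Proof.
move=> [[mf fi] _].
have tr := transports_prod P (transports_gauss_proj t).
split; first by have [mT _] := tr; exact: (measurableT_comp mf mT).
have := transports_integrable tr _ fi; apply.
by apply/measurable_EFinP; exact: measurable_funX.
Qed.

Lemma measurable_corr_integrand f g :
    measurable_fun setT (fun w : Z * T => f w.1 w.2) ->
    measurable_fun setT (fun w : Z * T => g w.1 w.2) ->
  measurable_fun setT (fun w : Z * (T * T) => (f w.1 w.2.1 * g w.1 w.2.2)%:E).
Proof.
move=> mf mg; apply/measurable_EFinP; apply: measurable_funM.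
- apply: (measurableT_comp (f := fun w : Z * T => f w.1 w.2)
    (g := fun w : Z * (T * T) => (w.1, w.2.1))) => //.
  apply/measurable_fun_pair => //=.
  exact: measurableT_comp.
- apply: (measurableT_comp (f := fun w : Z * T => g w.1 w.2)
    (g := fun w : Z * (T * T) => (w.1, w.2.2))) => //.
  apply/measurable_fun_pair => //=.
  exact: measurableT_comp.
Qed.

(** Stationarity: by rotation invariance the pair of directions [s], [t] has a law depending only on
    [cos (s - t)]. *)
Lemma ip_process L L' f g s t : lipscore L f -> lipscore L' g ->
  ip mu (process f s) (process g t) = corr f g (cos (s - t)).
Proof.
move=> [[mf _] _] [[mg _] _].
have tr := transports_prod P (transports_gauss_pair s t).
by rewrite /corr (transports_integral tr (measurable_corr_integrand mf mg)).
Qed.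

Lemma ip_process_diag L f t : lipscore L f ->
  ip mu (process f t) (process f t) =
  fine (\int[P \x gamma]_w (f w.1 w.2 ^+ 2)%:E).
Proof.
move=> [[mf _] _].
have tr := transports_prod P (transports_gauss_proj t).
have mf2 : measurable_fun setT (fun w : Z * T => (f w.1 w.2 ^+ 2)%:E).
  by apply/measurable_EFinP; exact: measurable_funX.
by rewrite (transports_integral tr mf2).
Qed.

End correlation.

(** * Algebra and regularity of the correlation *)

Section correlation_properties.
Context d (Z : measurableType d) (R : realType) (P : probability Z R).
Notation gamma := (@std_normal R).
Notation T := (measurableTypeR R).
Notation mu := (P \x @gauss2 R)%E.
Implicit Types (f g h : Z -> R -> R) (L : R).
Notation lipscore := (lipscore P).
Notation corr := (corr P).

Lemma lipscore_id : lipscore 1 (fun _ x => x).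
Proof.
split=> [|z a b]; last by rewrite mul1r.
split; first exact: measurable_snd.
have tr := transports_snd P gamma.
apply: (transports_integrable tr (f := fun x : T => (x ^+ 2)%:E)).
  by apply/measurable_EFinP; exact: measurable_funX.
apply/integrableP; split; first by apply/measurable_EFinP; exact: measurable_funX.
under eq_integral do rewrite /= ger0_norm ?sqr_ge0//.
exact: std_normal_sqr_lty.
Qed.

Lemma lipscoreD L L' f g : lipscore L f -> lipscore L' g ->
  lipscore (L + L') (fun z x => f z x + g z x).
Proof.
move=> [sf lf] [sg lg]; split; first exact: (sqintD sf sg).
move=> z a b; rewrite opprD addrACA mulrDl (le_trans (ler_normD _ _))//.
exact: lerD.
Qed.

Lemma lipscoreZ L f c : lipscore L f -> lipscore (`|c| * L) (fun z x => c * f z x).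
Proof.
move=> [sf lf]; split; first exact: (sqintZ c sf).
by move=> z a b; rewrite -mulrBr normrM -mulrA ler_wpM2l.
Qed.

Lemma lipscoreB L L' f g : lipscore L f -> lipscore L' g ->
  lipscore (L + L') (fun z x => f z x - g z x).
Proof.
move=> [sf lf] [sg lg]; split; first exact: (sqintB sf sg).
move=> z a b; rewrite opprD addrACA -opprD mulrDl.
by rewrite (le_trans (ler_normB _ _))// lerD.
Qed.

Lemma gauss_projDpi (t : R) p : gauss_proj (t + pi) p = - gauss_proj t p.
Proof. by rewrite /gauss_proj cosDpi sinDpi; ring. Qed.

(** The normal law is symmetric: [N_pi] is the opposite of [N_0] and has the same law. *)
Lemma lipscore_opp L f : lipscore L f -> lipscore L (fun z x => f z (- x)).
Proof.
move=> [[mf sf] lf]; split; last first.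
  by move=> z a b; rewrite (le_trans (lf _ _ _))// -opprD normrN.
have mN : measurable_fun setT (fun w : Z * T => (w.1, - w.2 : T)).
  by apply/measurable_fun_pair => //=; exact: measurableT_comp.
have mfN : measurable_fun setT (fun w : Z * T => f w.1 (- w.2)).
  exact: (measurableT_comp mf mN).
split => //.
have tr := transports_prod P (@transports_gauss_proj R pi).
have tr0 := transports_prod P (@transports_gauss_proj R 0).
have mfN2 : measurable_fun setT (fun w : Z * T => (f w.1 (- w.2) ^+ 2)%:E).
  by apply/measurable_EFinP; exact: measurable_funX.
have mf2 : measurable_fun setT (fun w : Z * T => (f w.1 w.2 ^+ 2)%:E).
  by apply/measurable_EFinP; exact: measurable_funX.
apply/integrableP; split => //.
have [_ fi] := integrableP _ _ _ sf.
rewrite (_ : \int[_]_x _ = \int[P \x gamma]_x `|(f x.1 x.2 ^+ 2)%:E|)%E//.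
have [_ h] := tr; have [_ h0] := tr0.
rewrite (h (fun w => `|(f w.1 (- w.2) ^+ 2)%:E|)%E)//; last exact: measurableT_comp.
rewrite (h0 (fun w => `|(f w.1 w.2 ^+ 2)%:E|)%E)//; last exact: measurableT_comp.
apply: eq_integral => w _ /=.
by rewrite -{1}(add0r pi) gauss_projDpi opprK.
Qed.

Let cosE (eta : R) : -1 <= eta <= 1 -> cos (acos eta - 0) = eta.
Proof. by move=> h; rewrite subr0 acosK// in_itv. Qed.

Lemma corrC L L' f g eta : lipscore L f -> lipscore L' g -> -1 <= eta <= 1 ->
  corr f g eta = corr g f eta.
Proof.
move=> sf sg h; rewrite -(cosE h) -(ip_process _ _ sf sg) ipC.
by rewrite (ip_process _ _ sg sf) -cosN opprB.
Qed.

Lemma corrDr L L' L'' f g h eta :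
    lipscore L f -> lipscore L' g -> lipscore L'' h -> -1 <= eta <= 1 ->
  corr f (fun z x => g z x + h z x) eta = corr f g eta + corr f h eta.
Proof.
move=> sf sg sh he; have sgh := lipscoreD sg sh.
rewrite -(cosE he) -!(ip_process _ _ sf sg, ip_process _ _ sf sh, ip_process _ _ sf sgh).
by rewrite -ipDr//; apply: sqint_process; eassumption.
Qed.

Lemma corrBr L L' L'' f g h eta :
    lipscore L f -> lipscore L' g -> lipscore L'' h -> -1 <= eta <= 1 ->
  corr f (fun z x => g z x - h z x) eta = corr f g eta - corr f h eta.
Proof.
move=> sf sg sh he; have sgh := lipscoreB sg sh.
rewrite -(cosE he) -!(ip_process _ _ sf sg, ip_process _ _ sf sh, ip_process _ _ sf sgh).
by rewrite -ipBr//; apply: sqint_process; eassumption.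
Qed.

Lemma corrZr L L' f g c eta : lipscore L f -> lipscore L' g -> -1 <= eta <= 1 ->
  corr f (fun z x => c * g z x) eta = c * corr f g eta.
Proof.
move=> sf sg he; have sgc := lipscoreZ c sg.
rewrite -(cosE he) -!(ip_process _ _ sf sg, ip_process _ _ sf sgc).
by rewrite -ipZr//; apply: sqint_process; eassumption.
Qed.

Lemma corr_opp L L' f g eta : lipscore L f -> lipscore L' g -> -1 <= eta <= 1 ->
  corr f g (- eta) = corr f (fun z x => g z (- x)) eta.
Proof.
move=> sf sg he; have sgN := lipscore_opp sg.
rewrite -(cosE he) -(ip_process _ _ sf sgN).
have -> : - cos (acos eta - 0) = cos (acos eta - (0 + pi)).
  by rewrite add0r subr0 cosB cospi sinpi; ring.
rewrite -(ip_process _ _ sf sg); apply: eq_Rintegral => w _.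
by rewrite /process gauss_projDpi.
Qed.

(** [N] at angle [- acos eta] is [eta * N_0] minus a multiple of [N] at angle [pi / 2]. The latter
    is orthogonal to [f(N_0)]: the angles [pi / 2] and [- (pi / 2)] give opposite variables with
    equal correlation to it. *)
Lemma corr_id L f eta : lipscore L f -> -1 <= eta <= 1 ->
  corr f (fun _ x => x) eta =
  eta * fine (\int[P \x gamma]_w (f w.1 w.2 * w.2)%:E).
Proof.
move=> sf he; have si := lipscore_id.
have s0 := sqint_process 0 sf.
have i0 := sqint_process 0 si; have i2 := sqint_process (pi / 2) si.
have orth : ip mu (process f 0) (process (fun _ x => x) (pi / 2)) = 0.
  have e1 := ip_process 0 (pi / 2) sf si.
  have e2 := ip_process 0 (- (pi / 2)) sf si.
  have e3 : ip mu (process f 0) (process (fun _ x => x) (- (pi / 2))) =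
      - ip mu (process f 0) (process (fun _ x => x) (pi / 2)).
    rewrite -[RHS]mulN1r -(ipZr (-1) i2 s0); apply: eq_Rintegral => w _; congr (_ * _).
    by rewrite /process /gauss_proj cosN sinN cos_pihalf sin_pihalf; ring.
  by move: e1 e2; rewrite !sub0r !cosN => <-; rewrite e3; lra.
have e0 : ip mu (process f 0) (process (fun _ x => x) 0) =
    fine (\int[P \x gamma]_w (f w.1 w.2 * w.2)%:E).
  have [[mf _] _] := sf.
  have tr := transports_prod P (@transports_gauss_proj R 0).
  have mf2 : measurable_fun setT (fun w : Z * T => (f w.1 w.2 * w.2)%:E).
    by apply/measurable_EFinP; apply: measurable_funM => //; exact: measurable_snd.
  by rewrite (transports_integral tr mf2).
rewrite -[in LHS](cosE he) subr0 -[acos eta]opprK -[- - acos eta]sub0r.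
rewrite -(ip_process _ _ sf si) -e0.
transitivity (ip mu (process f 0) (fun w => eta * process (fun _ x => x) 0 w +
    - sin (acos eta) * process (fun _ x => x) (pi / 2) w)).
  apply: eq_Rintegral => w _; congr (_ * _).
  rewrite /process /gauss_proj cosN sinN cos0 sin0 cos_pihalf sin_pihalf.
  by rewrite acosK ?in_itv//; ring.
rewrite ipDr ?ipZr//; [|exact: sqintZ..].
by rewrite orth mulr0 addr0.
Qed.

Lemma cauchy_schwarz_corr L L' f g eta : lipscore L f -> lipscore L' g ->
    -1 <= eta <= 1 ->
  corr f g eta ^+ 2 <=
    fine (\int[P \x gamma]_w (f w.1 w.2 ^+ 2)%:E) *
    fine (\int[P \x gamma]_w (g w.1 w.2 ^+ 2)%:E).
Proof.
move=> sf sg he; rewrite -(cosE he) -(ip_process _ _ sf sg).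
rewrite -(ip_process_diag (acos eta) sf) -(ip_process_diag 0 sg).
by apply: ip_cauchy_schwarz; apply: sqint_process; eassumption.
Qed.

Lemma ip_process_increments L L' f g s s' t t' : lipscore L f -> lipscore L' g ->
  ip mu (fun w => process f s w - process f s' w)
        (fun w => process g t w - process g t' w) =
  corr f g (cos (s - t)) - corr f g (cos (s - t')) -
  (corr f g (cos (s' - t)) - corr f g (cos (s' - t'))).
Proof.
move=> sf sg; have Sf r := sqint_process r sf; have Sg r := sqint_process r sg.
rewrite (ipBl (Sf s) (Sf s') (sqintB (Sg t) (Sg t'))).
rewrite (ipBr (Sg t) (Sg t') (Sf s)) (ipBr (Sg t) (Sg t') (Sf s')).
by rewrite (ip_process s t sf sg) (ip_process s t' sf sg)
  (ip_process s' t sf sg) (ip_process s' t' sf sg).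
Qed.

(** A square-integrable Lipschitz constant for the path [t -> N_t]. *)
Definition gauss_abs (w : Z * (T * T)) : R := `|w.2.1| + `|w.2.2|.

Lemma sqint_gauss_abs : sqint mu gauss_abs.
Proof.
have si := lipscore_id.
have := sqintD (sqint_norm (sqint_process 0 si)) (sqint_norm (sqint_process (pi / 2) si)).
congr (sqint mu _); apply/funext => w; rewrite /process /gauss_proj /gauss_abs.
by rewrite cos0 sin0 cos_pihalf sin_pihalf !mul1r !mul0r addr0 add0r.
Qed.

Lemma lipscore_ge0 L f (z : Z) : lipscore L f -> 0 <= L.
Proof.
move=> [_ /(_ z 1 0)]; rewrite subr0 normr1 mulr1; exact: le_trans.
Qed.

Lemma process_lipschitz L f s t w : lipscore L f ->
  `|process f s w - process f t w| <= L * (`|s - t| * gauss_abs w).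
Proof.
move=> sf; have L0 := lipscore_ge0 w.1 sf; have [_ lf] := sf.
rewrite (le_trans (lf _ _ _))// ler_wpM2l// /gauss_abs /gauss_proj.
rewrite opprD addrACA -!mulrBl (le_trans (ler_normD _ _))// mulrDr !normrM.
by rewrite lerD// ler_wpM2r// ?cos_lipschitz ?sin_lipschitz.
Qed.

(** The mixed difference is an inner product of two increments of sizes [|k|] and [|m|], and a
    simple difference is an inner product with one increment. *)
Lemma derivable_corr_cos L L' f g t : lipscore L f -> lipscore L' g ->
  derivable (corr f g \o cos) t 1.
Proof.
move=> sf sg; have Sf r := sqint_process r sf; have Sg r := sqint_process r sg.
have SV := sqint_gauss_abs.
apply: (derivable_mixed_difference
  (C := L * L' * ip mu gauss_abs gauss_abs)
  (D := L * ip mu gauss_abs (fun w => `|process g 0 w|))).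
- move=> k m; rewrite /=.
  (* With the angles [t + k], [t] against [- m], [0], the four differences are those of the mixed
     difference at [t]. *)
  have := ip_process_increments (t + k) t (- m) 0 sf sg.
  rewrite !opprK !subr0 => e.
  rewrite (_ : _ + _ = ip mu (fun w => process f (t + k) w - process f t w)
                       (fun w => process g (- m) w - process g 0 w)); last first.
    by rewrite e (addrA t) [in RHS]opprB [in RHS]addrA [in RHS]addrAC.
  rewrite mulrAC; apply: norm_ip_le => //; [exact: sqintB..|move=> w].
  have := process_lipschitz (t + k) t w sf; have := process_lipschitz (- m) 0 w sg.
  rewrite (addrC t) addrK subr0 normrN normrM => h1 h2.
  apply: (le_trans (ler_pM (normr_ge0 _) (normr_ge0 _) h2 h1)).
  by rewrite le_eqVlt; apply/orP; left; apply/eqP; ring.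
- move=> k /=.
  have -> : corr f g (cos (t + k)) - corr f g (cos t) =
      ip mu (fun w => process f (t + k) w - process f t w) (process g 0).
    rewrite (ipBl (Sf (t + k)) (Sf t) (Sg 0)).
    by rewrite (ip_process (t + k) 0 sf sg) (ip_process t 0 sf sg) !subr0.
  rewrite mulrAC; apply: norm_ip_le => //; [exact: sqintB|exact: sqint_norm|move=> w].
  have := process_lipschitz (t + k) t w sf.
  rewrite (addrC t) addrK normrM => h.
  apply: (le_trans (ler_wpM2r (normr_ge0 _) h)).
  by rewrite le_eqVlt; apply/orP; left; apply/eqP; ring.
Qed.

End correlation_properties.

(** * Monotonicity and end-point slopes of the correlation *)

Section correlation_monotone.
Context d (Z : measurableType d) (R : realType) (P : probability Z R).
Notation gamma := (@std_normal R).
Notation T := (measurableTypeR R).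
Notation mu := (P \x @gauss2 R)%E.
Implicit Types (f g h : Z -> R -> R) (L : R).
Notation lipscore := (lipscore P).
Notation corr := (corr P).

(* Two symmetric pairs of angles with the same bisector: both increments are then
   taken along the same direction of the plane, so they have the same sign. *)
Lemma corr_increment L L' f g (e1 e2 : R) : lipscore L f -> lipscore L' g ->
    -1 <= e1 <= 1 -> -1 <= e2 <= 1 ->
    let p := (acos e1 + acos e2) / 2 in let q := (acos e1 - acos e2) / 2 in
  2 * (corr f g e2 - corr f g e1) =
  ip mu (fun w => process f p w - process f (- p) w)
        (fun w => process g q w - process g (- q) w).
Proof.
move=> sf sg h1 h2 p q; rewrite (ip_process_increments p (- p) q (- q) sf sg).
have -> : - p - q = - acos e1 by rewrite /p /q; field.
have -> : - p - - q = - acos e2 by rewrite /p /q; field.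
have -> : p - q = acos e2 by rewrite /p /q; field.
have -> : p - - q = acos e1 by rewrite /p /q; field.
rewrite !cosN !acosK ?in_itv//.
by move: (corr f g e1) (corr f g e2) => a b; ring.
Qed.

Lemma gauss_proj_symm (p : R) (x : T * T) :
  gauss_proj p x - gauss_proj (- p) x = 2 * sin p * x.2.
Proof. by rewrite /gauss_proj cosN sinN; ring. Qed.

Lemma process_increment_ge0 f g p q w :
    (forall z, {homo f z : a b / a <= b}) -> (forall z, {homo g z : a b / a <= b}) ->
    0 <= sin p -> 0 <= sin q ->
  0 <= (process f p w - process f (- p) w) * (process g q w - process g (- q) w).
Proof.
move=> mf mg sp sq; rewrite /process.
have := gauss_proj_symm p w.2; have := gauss_proj_symm q w.2.
have [w0|/ltW w0] := leP 0 w.2.2.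
- have : 0 <= 2 * sin p * w.2.2 by rewrite !mulr_ge0.
  have : 0 <= 2 * sin q * w.2.2 by rewrite !mulr_ge0.
  by move=> h1 h2 e1 e2; rewrite mulr_ge0// subr_ge0 ?mf ?mg// -subr_ge0 ?e1 ?e2.
- have : 2 * sin p * w.2.2 <= 0 by rewrite mulr_ge0_le0// mulr_ge0.
  have : 2 * sin q * w.2.2 <= 0 by rewrite mulr_ge0_le0// mulr_ge0.
  by move=> h1 h2 e1 e2; rewrite mulr_le0// subr_le0 ?mf ?mg// -subr_le0 ?e1 ?e2.
Qed.

Let sin_half_sum (e1 e2 : R) : -1 <= e1 <= 1 -> -1 <= e2 <= 1 -> e1 <= e2 ->
  0 <= (acos e1 + acos e2) / 2 <= pi /\ 0 <= (acos e1 - acos e2) / 2 <= pi.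
Proof.
move=> h1 h2; have := acos_ge0 h1; have := acos_ge0 h2.
have := acos_lepi h1; have := acos_lepi h2.
move: h1 h2 => /acos_def[a1 c1] /acos_def[a2 c2] a2p a1p a20 a10 e12.
have : acos e2 <= acos e1.
  by rewrite leNgt -ltr_cos ?in_itv//= c1 c2 -leNgt.
by split; lra.
Qed.

Lemma corr_nondecreasing L L' f g (e1 e2 : R) : lipscore L f -> lipscore L' g ->
    (forall z, {homo f z : a b / a <= b}) -> (forall z, {homo g z : a b / a <= b}) ->
    -1 <= e1 <= 1 -> -1 <= e2 <= 1 -> e1 <= e2 ->
  corr f g e1 <= corr f g e2.
Proof.
move=> sf sg mf mg h1 h2 e12; have [hp hq] := sin_half_sum h1 h2 e12.
rewrite -subr_ge0 -(@pmulr_rge0 _ 2)// (corr_increment sf sg h1 h2).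
by apply: ip_ge0 => w; apply: process_increment_ge0 => //; exact: sin_ge0_pi.
Qed.

(* By stationarity, the L2 norm of process f t - process f 0 is subadditive in t. *)
Lemma cvg_corr_slope_diag L f : lipscore L f ->
  cvg ((corr f f 1 - corr f f (cos t)) / t ^+ 2 @[t --> 0^'+]).
Proof.
move=> sf; have Sf r := sqint_process r sf.
pose D s t w := process f s w - process f t w.
have SD s t : sqint mu (D s t) by exact: sqintB.
have DE s t : ip mu (D s t) (D s t) = 2 * (corr f f 1 - corr f f (cos (s - t))).
  rewrite (ip_process_increments s t s t sf sf) (subrr s) (subrr t) cos0.
  rewrite -(opprB s t) cosN.
  by move: (corr f f 1) (corr f f _) => a b; ring.
pose dd t := Num.sqrt (ip mu (D t 0) (D t 0)).
have dE t : dd t ^+ 2 = 2 * (corr f f 1 - corr f f (cos t)).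
  by rewrite sqr_sqrtr; [rewrite DE (subr0 t)|exact: ipxx_ge0].
have z0 : Z by exact: point.
have L0 := lipscore_ge0 z0 sf.
have /cvg_ex[l /= dl] : cvg (dd t / t @[t --> 0^'+]).
  apply: (@subadditive_slope_cvg _ _ (L * Num.sqrt (ip mu (@gauss_abs _ Z R) (@gauss_abs _ Z R)))).
  - move=> s t s0 t0.
    have -> : dd s = Num.sqrt (ip mu (D (s + t) t) (D (s + t) t)).
      by rewrite /dd !DE (addrK t) (subr0 s).
    rewrite /dd; apply: le_trans (ip_minkowski (SD (s + t) t) (SD t 0)).
    rewrite le_eqVlt; apply/orP; left; apply/eqP; congr Num.sqrt.
    by apply: eq_Rintegral => w _; rewrite /D addrA subrK.
  - by rewrite /dd DE (subr0 0) cos0 (subrr (corr f f 1)) mulr0 sqrtr0.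
  - move=> t t0; rewrite mulrAC -[L * t]ger0_norm ?mulr_ge0 ?(ltW t0)// -sqrtr_sqr.
    rewrite -sqrtrM ?sqr_ge0// ler_wsqrtr// (le_trans (ler_norm _))//.
    apply: norm_ip_le => //; [exact: sqint_gauss_abs|exact: sqint_gauss_abs|move=> w].
    have := process_lipschitz t 0 w sf; rewrite subr0 (gtr0_norm t0) => h.
    rewrite normrM (le_trans (ler_pM (normr_ge0 _) (normr_ge0 _) h h))//.
    by rewrite le_eqVlt; apply/orP; left; apply/eqP; ring.
apply/cvg_ex; exists (2^-1 * (l * l)).
rewrite (_ : (fun t => _) = (fun t => 2^-1 * ((dd t / t) * (dd t / t)))).
  by apply: cvgMr; exact: cvgM.
apply/funext => t; rewrite -expr2 expr_div_n dE.
by move: (corr f f 1 - _) => a; rewrite mulrA mulrA mulVf ?mul1r// pnatr_eq0.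
Qed.

Lemma cvg_corr_slope1 L L' f g : lipscore L f -> lipscore L' g ->
  cvg ((corr f g 1 - corr f g (1 * cos t)) / t ^+ 2 @[t --> 0^'+]).
Proof.
move=> sf sg; have sD := lipscoreD sf sg; have sB := lipscoreB sf sg.
pose S z x := f z x + g z x; pose B z x := f z x - g z x.
have pol e : -1 <= e <= 1 -> corr f g e = 4^-1 * (corr S S e - corr B B e).
  move=> he; have cg : corr g f e = corr f g e by rewrite (corrC sf sg he).
  have -> : corr S S e = corr f f e + corr f g e + (corr f g e + corr g g e).
    rewrite (corrDr sD sf sg he) (corrC sD sf he) (corrC sD sg he).
    by rewrite (corrDr sf sf sg he) (corrDr sg sf sg he) cg.
  have -> : corr B B e = corr f f e - corr f g e - (corr f g e - corr g g e).
    rewrite (corrBr sB sf sg he) (corrC sB sf he) (corrC sB sg he).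
    by rewrite (corrBr sf sf sg he) (corrBr sg sf sg he) cg.
  by move: (corr f f e) (corr f g e) (corr g g e) => a b c; field.
have /cvg_ex[a /= ca] := cvg_corr_slope_diag sD.
have /cvg_ex[b /= cb] := cvg_corr_slope_diag sB.
apply/cvg_ex; exists (4^-1 * (a - b)).
have c1 (t : R) : -1 <= cos t <= 1 by rewrite cos_geN1 cos_le1.
have h11 : -1 <= (1 : R) <= 1 by rewrite lexx andbT; lra.
rewrite (_ : (fun t => _) = (fun t =>
  4^-1 * ((corr S S 1 - corr S S (cos t)) / t ^+ 2 -
          (corr B B 1 - corr B B (cos t)) / t ^+ 2))).
  by apply: cvgMr; exact: cvgB.
apply/funext => t; rewrite mul1r (pol 1 h11) (pol (cos t) (c1 t)).
move: (corr S S 1) (corr B B 1) (corr S S _) (corr B B _) => u v x y.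
by move: (t ^+ 2)^-1 => w; ring.
Qed.

Lemma cvg_corr_slopeN1 L L' f g : lipscore L f -> lipscore L' g ->
  cvg ((corr f g (-1) - corr f g (-1 * cos t)) / t ^+ 2 @[t --> 0^'+]).
Proof.
move=> sf sg; have c1 (t : R) : -1 <= cos t <= 1 by rewrite cos_geN1 cos_le1.
have h11 : -1 <= (1 : R) <= 1 by rewrite lexx andbT; lra.
rewrite (_ : (fun t => _) = (fun t => (corr f (fun z x => g z (- x)) 1 -
    corr f (fun z x => g z (- x)) (1 * cos t)) / t ^+ 2)).
  exact: cvg_corr_slope1 sf (lipscore_opp sg).
apply/funext => t.
by rewrite mulN1r mul1r (corr_opp sf sg h11) (corr_opp sf sg (c1 t)).
Qed.

Lemma differentiable_within_corr L L' f g : lipscore L f -> lipscore L' g ->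
  differentiable_within `[-1, 1] (corr f g).
Proof.
move=> sf sg; apply: differentiable_within_cos.
- by move=> t; exact: (derivable_corr_cos sf sg).
- exact: cvg_corr_slope1 sf sg.
- exact: cvg_corr_slopeN1 sf sg.
Qed.

End correlation_monotone.

(** * Strict monotonicity of the correlation *)

Section correlation_increasing.
Context d (Z : measurableType d) (R : realType) (P : probability Z R).
Notation gamma := (@std_normal R).
Notation T := (measurableTypeR R).
Notation mu := (P \x @gauss2 R)%E.
Implicit Types (f g h : Z -> R -> R) (L : R).
Notation lipscore := (lipscore P).
Notation corr := (corr P).

(** On [[a, b]] the density is at least [c], its value at [M], because [M] bounds [|x|] there. *)
Lemma std_normal_itv_gt0 (a b : R) : a < b -> (0 < gamma `[a, b]%classic)%E.
Proof.
move=> ab; pose M := `|a| + `|b|.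
pose c := normal_peak 1 * expR (- M ^+ 2 / 2).
have c0 : 0 < c.
  by rewrite mulr_gt0 ?expR_gt0//; apply: normal_peak_gt0; exact: oner_neq0.
have -> : gamma `[a, b]%classic = (\int[lebesgue_measure]_(x in `[a, b]) (normal_pdf 0 1 x)%:E)%E.
  by [].
apply: (@lt_le_trans _ _ (\int[lebesgue_measure]_(x in `[a, b]) (cst c%:E x))%E).
  rewrite integral_cst//= lebesgue_measure_itv/= lte_fin ab -EFinD -EFinM lte_fin.
  by rewrite mulr_gt0// subr_gt0.
apply: ge0_le_integral => //.
- by move=> x _; rewrite lee_fin ltW.
- by apply/measurable_EFinP; apply: measurable_funTS; exact: measurable_normal_pdf.
- move=> x /=; rewrite in_itv/= => /andP[ax xb]; rewrite lee_fin.
  have -> : normal_pdf 0 1 x = normal_peak 1 * expR (- x ^+ 2 / 2).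
    by rewrite /normal_pdf oner_eq0 /normal_fun subr0 expr1n.
  rewrite ler_pM2l ?normal_peak_gt0 ?oner_neq0// ler_expR ler_pM2r ?invr_gt0// lerN2.
  rewrite -(real_normK (num_real x)) lerXn2r ?nnegrE ?addr_ge0//.
  have := ler_norm b; have := ler_norm (- a); rewrite normrN ler_norml /M.
  by have := normr_ge0 a; have := normr_ge0 b; lra.
Qed.

Lemma ae_ex d' (U : measurableType d') (m : {measure set U -> \bar R}) (Q : U -> Prop) A :
  measurable A -> (0 < m A)%E -> {ae m, forall x, Q x} -> exists2 x, A x & Q x.
Proof.
move=> mA A0 [N [mN N0 QN]]; apply: contrapT => h.
suff : (m A <= m N)%E by rewrite N0 leNgt A0.
apply: le_measure; rewrite ?inE// => x Ax; apply: QN => /= Qx.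
by apply: h; exists x.
Qed.

Lemma ge0_integral_eq0_ex d' (U : measurableType d') (m : {measure set U -> \bar R})
    (F : U -> \bar R) A :
    measurable_fun setT F -> (forall x, 0 <= F x)%E -> (\int[m]_x F x = 0)%E ->
    measurable A -> (0 < m A)%E ->
  exists2 x, A x & F x = 0%E.
Proof.
move=> mF F0 iF mA A0; apply: (ae_ex mA A0).
have [+ _] := @ae_eq_integral_abs _ _ _ m _ measurableT F mF.
under eq_integral do rewrite gee0_abs//.
by move=> /(_ iF); apply: filterS => x /(_ I).
Qed.

(** For bounded [x], a large [w] pushes the directions [p], [q] above any level and [- p], [- q]
    below any level. The unit interval for [w] makes this happen with positive probability. *)
Lemma gauss_proj_spread (p q a b a' b' : R) : 0 < sin p -> 0 < sin q ->
  exists M, forall x w : R, x \in `[-1, 1] -> w \in `[M, M + 1] ->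
    [/\ b <= gauss_proj p (x, w), gauss_proj (- p) (x, w) <= a,
        b' <= gauss_proj q (x, w) & gauss_proj (- q) (x, w) <= a'].
Proof.
move=> sp sq.
have le_ratio (s s' c c' : R) : 0 < s -> 0 < s' -> 0 <= c' -> c <= s * (c / s + c' / s').
  move=> s0 s'0 c0; have -> : s * (c / s + c' / s') = c + s * (c' / s').
    by field; rewrite !gt_eqF.
  by rewrite lerDl mulr_ge0 ?divr_ge0// ltW.
have n1 (x y : R) : 0 <= 1 + `|x| + `|y| by rewrite !addr_ge0.
(* One summand for each angle, the other summand being nonnegative; the 1 absorbs the cosine
   term. *)
exists ((1 + `|a| + `|b|) / sin p + (1 + `|a'| + `|b'|) / sin q) => x w.
have := le_ratio _ _ (1 + `|a| + `|b|) _ sp sq (n1 a' b').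
have := le_ratio _ _ (1 + `|a'| + `|b'|) _ sq sp (n1 a b).
rewrite [_ / sin q + _]addrC; set M := _ / _ + _ => Mq Mp.
rewrite !in_itv/= => xI /andP[Mw _].
have bound r u v : 0 < sin r -> 1 + `|u| + `|v| <= sin r * M ->
    v <= gauss_proj r (x, w) /\ gauss_proj (- r) (x, w) <= u.
  move=> sr h; rewrite /gauss_proj cosN sinN /=.
  have : sin r * M <= sin r * w by rewrite ler_pM2l.
  have : `|cos r * x| <= 1.
    rewrite normrM mulr_ile1//; first by rewrite ler_norml cos_geN1 cos_le1.
    by rewrite ler_norml.
  rewrite ler_norml => /andP[? ?] ?.
  have := ler_norm v; have := ler_norm (- u); rewrite normrN.
  have := normr_ge0 u; have := normr_ge0 v.
  by split; lra.
by have [? ?] := bound p a b sp Mp; have [? ?] := bound q a' b' sq Mq.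
Qed.

(** Equality would make the nonnegative integrand of [corr_increment] vanish almost everywhere, but
    it is positive on a rectangle where both functions jump. *)
Lemma corr_increasing L L' f g (e1 e2 : R) : lipscore L f -> lipscore L' g ->
    (forall z, {homo f z : a b / a <= b}) -> (forall z, {homo g z : a b / a <= b}) ->
    (forall z, exists a b, f z a < f z b) -> (forall z, exists a b, g z a < g z b) ->
    -1 <= e1 <= 1 -> -1 <= e2 <= 1 -> e1 < e2 ->
  corr f g e1 < corr f g e2.
Proof.
move=> sf sg mf mg ncf ncg h1 h2 e12.
pose p := (acos e1 + acos e2) / 2; pose q := (acos e1 - acos e2) / 2.
have [sp sq] : 0 < sin p /\ 0 < sin q.
  have a21 : acos e2 < acos e1.
    have [a1 c1] := acos_def h1; have [a2 c2] := acos_def h2.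
    by move: e12; rewrite -{1}c1 -{1}c2 ltr_cos ?in_itv.
  have := acos_ge0 h2; have := acos_lepi h1.
  by split; apply: sin_gt0_pi; rewrite /p /q; lra.
rewrite lt_neqAle (corr_nondecreasing sf sg mf mg h1 h2 (ltW e12)) andbT.
apply/eqP => ceq.
pose X w := (process f p w - process f (- p) w) * (process g q w - process g (- q) w).
have X0 w : 0 <= X w := process_increment_ge0 w mf mg (ltW sp) (ltW sq).
have SX : mu.-integrable setT (EFin \o X).
  exact: (sqint_mul_integrable
    (sqintB (sqint_process p sf) (sqint_process (- p) sf))
    (sqintB (sqint_process q sg) (sqint_process (- q) sg))).
have mX := measurable_int _ SX.
have iX : (\int[mu]_w (X w)%:E = 0)%E.
  have := corr_increment sf sg h1 h2 => /=; rewrite -/p -/q ceq subrr mulr0 => e.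
  rewrite -(fineK (integrable_fin_num measurableT SX)); congr EFin.
  exact/esym.
have X0' w : (0 <= (EFin \o X) w)%E by rewrite lee_fin.
(* Tonelli first yields one [z] whose fibre integral vanishes: the levels where [f z] and [g z]
   increase, hence the rectangle, depend on [z]. *)
move: iX; rewrite (fubini_tonelli1 _ mX X0') => iX.
have mF := measurable_fun_fubini_tonelli_F _ mX X0' : measurable_fun setT (fubini_F gauss2 (EFin \o X)).
have F0 z : (0 <= fubini_F (@gauss2 R) (EFin \o X) z)%E by exact: integral_ge0.
have PT : (0 < P setT)%E by rewrite probability_setT.
have [z _ Fz] := ge0_integral_eq0_ex mF F0 iX measurableT PT.
have [a1 [b1 fab]] := ncf z; have [a2 [b2 gab]] := ncg z.
have [M hM] := gauss_proj_spread a1 b1 a2 b2 sp sq.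
pose I1 : set T := `[-1, 1]%classic; pose J : set T := `[M, M + 1]%classic.
have mI1 : measurable I1 := measurable_itv _.
have mJ : measurable J := measurable_itv _.
have mA : measurable (I1 `*` J) := measurableX mI1 mJ.
have N11 : -1 < 1 :> R by rewrite -subr_gt0 opprK.
have M1 : M < M + 1 by rewrite ltrDl.
have I10 : (0 < gamma I1)%E := std_normal_itv_gt0 N11.
have J0 : (0 < gamma J)%E := std_normal_itv_gt0 M1.
have A0 : (0 < @gauss2 R (I1 `*` J))%E.
  have -> : (@gauss2 R (I1 `*` J) = gamma I1 * gamma J)%E := product_measure1E _ _ mI1 mJ.
  exact: mule_gt0.
have mXz : measurable_fun setT (fun w => (X (z, w))%:E).
  exact: (measurableT_comp mX).
have [[x w] [/= xI wI]] :=
  ge0_integral_eq0_ex mXz (fun w => X0' (z, w)) Fz mA A0.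
have [p1 p2 q1 q2] := hM x w xI wI.
have : 0 < X (z, (x, w)).
  apply: mulr_gt0; rewrite subr_gt0.
  - exact: (le_lt_trans (mf z _ _ p2) (lt_le_trans fab (mf z _ _ p1))).
  - exact: (le_lt_trans (mg z _ _ q2) (lt_le_trans gab (mg z _ _ q1))).
by move=> + [Xz]; rewrite Xz ltxx.
Qed.

End correlation_increasing.

(** * Lipschitz bounds and the fixed point *)

Section monotone_scores.
Context d (Z : measurableType d) (R : realType) (P : probability Z R).
Notation gamma := (@std_normal R).
Notation T := (measurableTypeR R).
Implicit Types (f g : Z -> R -> R) (K : R).
Notation lipscore := (lipscore P).
Notation corr := (corr P).

(** Slopes between 0 and [K], phrased as the monotonicity of the two functions to which
    [corr_nondecreasing] is applied. *)
Record monoscore K f := MonoScore {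
  monoscore_sqint : sqint (P \x gamma)%E (fun w : Z * T => f w.1 w.2) ;
  monoscore_le : forall z, {homo f z : a b / a <= b} ;
  monoscore_ge : forall z, {homo (fun x => K * x - f z x) : a b / a <= b} }.

(** The moment E[f(X) X], which the last two equations of System A prescribe; [energy] is the one in
    the first two. *)
Definition gain f := fine (\int[P \x gamma]_w (f w.1 w.2 * w.2)%:E).
Definition energy f := fine (\int[P \x gamma]_w (f w.1 w.2 ^+ 2)%:E).

Lemma monoscore_lip K f : monoscore K f -> lipscore K f.
Proof.
move=> [sf fl fg]; split=> // z.
suff le_case a b : a <= b -> `|f z b - f z a| <= K * `|b - a|.
  move=> a b; have [ab|/ltW ba] := leP a b; last exact: le_case.
  by rewrite distrC (distrC a); exact: le_case.
move=> ab; have := fl z _ _ ab; have := fg z _ _ ab => h1 h2.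
by rewrite !ger0_norm ?subr_ge0//; lra.
Qed.

Lemma monoscore_coscore K f : monoscore K f ->
  lipscore (`|K| * 1 + K) (fun z x => K * x - f z x).
Proof.
by move=> /monoscore_lip sf; exact: lipscoreB (lipscoreZ K (lipscore_id P)) sf.
Qed.

Lemma corr_coscore K K' f g e : monoscore K f -> monoscore K' g -> -1 <= e <= 1 ->
  corr f (fun z x => K' * x - g z x) e = K' * (e * gain f) - corr f g e.
Proof.
move=> /monoscore_lip sf /monoscore_lip sg he; have si := lipscore_id P.
by rewrite (corrBr sf (lipscoreZ K' si) sg he) (corrZr K' sf si he) (corr_id sf he).
Qed.

Lemma corr_increment_le K K' f g e1 e2 : monoscore K f -> monoscore K' g ->
    -1 <= e1 <= 1 -> -1 <= e2 <= 1 -> e1 <= e2 ->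
  corr f g e2 - corr f g e1 <= K' * gain f * (e2 - e1).
Proof.
move=> sf sg h1 h2 e12.
have := corr_nondecreasing (monoscore_lip sf) (monoscore_coscore sg)
  (monoscore_le sf) (monoscore_ge sg) h1 h2 e12.
rewrite (corr_coscore sf sg h1) (corr_coscore sf sg h2).
by move: (corr f g e1) (corr f g e2) (gain f) => a b m; lra.
Qed.

Lemma corr_increment_lt K K' f g e1 e2 : monoscore K f -> monoscore K' g ->
    (forall z, exists a b, f z a < f z b) ->
    (forall z, exists a b, K' * a - g z a < K' * b - g z b) ->
    -1 <= e1 <= 1 -> -1 <= e2 <= 1 -> e1 < e2 ->
  corr f g e2 - corr f g e1 < K' * gain f * (e2 - e1).
Proof.
move=> sf sg ncf ncg h1 h2 e12.
have := corr_increasing (monoscore_lip sf) (monoscore_coscore sg)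
  (monoscore_le sf) (monoscore_ge sg) ncf ncg h1 h2 e12.
rewrite (corr_coscore sf sg h1) (corr_coscore sf sg h2).
by move: (corr f g e1) (corr f g e2) (gain f) => a b m; lra.
Qed.

(** The symmetric bound has another constant. Products of the constants of [F_ell] and [F_phi]
    simplify only when the two kinds of bound are paired crosswise. *)
Lemma corr_increment_le_sym K K' f g e1 e2 : monoscore K f -> monoscore K' g ->
    -1 <= e1 <= 1 -> -1 <= e2 <= 1 -> e1 <= e2 ->
  corr f g e2 - corr f g e1 <= K * gain g * (e2 - e1).
Proof.
move=> sf sg h1 h2 e12.
rewrite (corrC (monoscore_lip sf) (monoscore_lip sg) h1).
rewrite (corrC (monoscore_lip sf) (monoscore_lip sg) h2).
exact: corr_increment_le sg sf h1 h2 e12.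
Qed.

Lemma monoscore_id : monoscore 1 (fun _ x => x).
Proof.
have [si _] := lipscore_id P; split=> [//|z a b //|z a b _].
by rewrite /= !mul1r !subrr.
Qed.

(** Such an [f] has slope bound 0, so its correlation with the identity, [eta * gain f], does not
    increase from -1 to 1. System A prescribes positive gains. *)
Lemma gain_constant K f : monoscore K f -> (forall z a b, f z a = f z b) -> gain f <= 0.
Proof.
move=> sf cf; have s0 : monoscore 0 f.
  have [si fl _] := sf; split=> [//|//|z a b _].
  by rewrite /= !mul0r (cf z a b).
have h1 : -1 <= (1 : R) <= 1 by rewrite lexx andbT; lra.
have hN1 : -1 <= (-1 : R) <= 1 by rewrite lexx; lra.
have le_N11 : -1 <= 1 :> R by lra.
have := corr_increment_le_sym s0 monoscore_id hN1 h1 le_N11.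
rewrite (corr_id (monoscore_lip s0) h1) (corr_id (monoscore_lip s0) hN1) -/(gain f).
by move: (gain f) => m; lra.
Qed.

End monotone_scores.

(** * Fixed points of a pair of monotone maps *)

Section coupled_maps.
Context {R : realType}.
Implicit Types F G : R -> R.

Lemma increment_lipschitz F (K : R) (x y : R) :
    (forall a b, -1 <= a <= 1 -> -1 <= b <= 1 -> a <= b -> 0 <= F b - F a <= K * (b - a)) ->
    -1 <= x <= 1 -> -1 <= y <= 1 ->
  `|F x - F y| <= K * `|x - y|.
Proof.
move=> h hx hy; have [xy|/ltW yx] := leP x y.
- have /andP[h1 h2] := h x y hx hy xy.
  by rewrite distrC (distrC x) ger0_norm// ger0_norm// subr_ge0.
- have /andP[h1 h2] := h y x hy hx yx.
  by rewrite ger0_norm// ger0_norm// subr_ge0.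
Qed.

Lemma comp_lipschitz F G (K L k : R) :
    (forall a b, -1 <= a <= 1 -> -1 <= b <= 1 -> a <= b -> 0 <= F b - F a <= K * (b - a)) ->
    (forall a b, -1 <= a <= 1 -> -1 <= b <= 1 -> a <= b -> 0 <= G b - G a <= L * (b - a)) ->
    (forall a, -1 <= a <= 1 -> -1 <= G a <= 1) -> 0 <= K -> K * L = k ->
  forall x y, -1 <= x <= 1 -> -1 <= y <= 1 -> `|F (G x) - F (G y)| <= k * `|x - y|.
Proof.
move=> hF hG GI K0 <- x y hx hy.
rewrite (le_trans (increment_lipschitz hF (GI _ hx) (GI _ hy)))// -mulrA ler_wpM2l//.
exact: increment_lipschitz hG hx hy.
Qed.

(** Knaster-Tarski: the supremum of the points with [x <= H x] is fixed. *)
Lemma nondecreasing_fixpoint (H : R -> R) :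
    (forall a, -1 <= a <= 1 -> -1 <= H a <= 1) ->
    (forall a b, -1 <= a <= 1 -> -1 <= b <= 1 -> a <= b -> H a <= H b) ->
  exists2 x, -1 <= x <= 1 & H x = x.
Proof.
move=> HI Hle; pose S := [set x | -1 <= x <= 1 /\ x <= H x].
have N11 : -1 <= (-1 : R) <= 1 by rewrite lexx; lra.
have hS : has_sup S.
  split; first by exists (-1); split => //; have /andP[] := HI _ N11.
  by exists 1 => x [/andP[]].
have sI : -1 <= sup S <= 1.
  apply/andP; split; last by apply: ge_sup; [case: hS|move=> x [/andP[]]].
  by apply: sup_upper_bound => //; split => //; have /andP[] := HI _ N11.
have sH : sup S <= H (sup S).
  apply: ge_sup; first by case: hS.
  move=> x [xI xH]; apply: (le_trans xH); apply: Hle => //.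
  exact: sup_upper_bound.
exists (sup S) => //; apply/eqP; rewrite eq_le sH andbT.
apply: sup_upper_bound => //; split; first exact: HI.
by apply: Hle => //; exact: HI.
Qed.

(** Existence is by monotonicity. If [a < b] were both fixed, then [G a < G b], and the strict bound
    for [F] would give [b - a < K * L * (b - a) <= b - a]. *)
Lemma coupled_fixpoint F G (K L : R) :
    (forall a b, -1 <= a <= 1 -> -1 <= b <= 1 -> a < b -> F b - F a < K * (b - a)) ->
    (forall a b, -1 <= a <= 1 -> -1 <= b <= 1 -> a <= b -> F a <= F b) ->
    (forall a b, -1 <= a <= 1 -> -1 <= b <= 1 -> a <= b -> 0 <= G b - G a <= L * (b - a)) ->
    (forall a, -1 <= a <= 1 -> -1 <= F a <= 1) ->
    (forall a, -1 <= a <= 1 -> -1 <= G a <= 1) ->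
    0 <= K -> K * L <= 1 ->
  exists y, [/\ -1 <= y <= 1, F (G y) = y &
    forall x, -1 <= x <= 1 -> F (G x) = x -> x = y].
Proof.
move=> Fs Fle hG FI GI K0 KL.
have [y yI yE] : exists2 y, -1 <= y <= 1 & F (G y) = y.
  apply: (@nondecreasing_fixpoint (F \o G)) => [a aI|a b aI bI ab] /=.
    by apply/FI/GI.
  apply: Fle; [exact: GI|exact: GI|].
  by have /andP[+ _] := hG _ _ aI bI ab; rewrite subr_ge0.
suff uniq a b : -1 <= a <= 1 -> -1 <= b <= 1 -> F (G a) = a -> F (G b) = b -> ~ (a < b).
  exists y; split=> // x xI xE; apply/eqP; rewrite eq_le !leNgt.
  by apply/andP; split; apply/negP; exact: uniq.
move=> aI bI aE bE ab.
have /andP[G0 GL] := hG _ _ aI bI (ltW ab).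
move: G0; rewrite subr_ge0 le_eqVlt => /predU1P[Gab|Gab].
  by move: ab; rewrite -aE -bE Gab ltxx.
have := Fs _ _ (GI _ aI) (GI _ bI) Gab; rewrite aE bE.
have := ler_wpM2l K0 GL; rewrite mulrA.
have : K * L * (b - a) <= 1 * (b - a) by rewrite ler_pM2r// subr_gt0.
lra.
Qed.

End coupled_maps.

(** * What System A says about the two scores *)

Section scores_of_system.
Context {R : realType}.
Notation gamma := (@std_normal R).
Notation T := (measurableTypeR R).
Implicit Types (P : probability T R) (E : R -> R).

(** Covers both functions of the system: [t = 0] with [E] the envelope derivative, and [t = 1] with
    [E] the proximal map. A finite second moment [r] gives square integrability. *)
Lemma monoscore_affine P E (k b t r : R) : {homo E : x y / x <= y} ->
    {homo (fun x => k * x - E x) : x y / x <= y} -> 0 <= b ->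
    (\int[P \x gamma]_w ((E (w.1 + b * w.2) - t * w.1) ^+ 2)%:E = r%:E)%E ->
  monoscore P (k * b) (fun z x => E (z + b * x) - t * z).
Proof.
move=> El Eg b0 Er.
have mE : measurable_fun setT E by exact: nondecreasing_measurable.
have mf : measurable_fun [set: T * T] (fun w : T * T => E (w.1 + b * w.2) - t * w.1).
  apply: measurable_funB.
    apply: (measurableT_comp mE); apply: measurable_funD; first exact: measurable_fst.
    by apply: measurable_funM => //; exact: measurable_snd.
  by apply: measurable_funM => //; exact: measurable_fst.
split.
- split => //; apply/integrableP; split.
    by apply/measurable_EFinP; exact: measurable_funX.
  under eq_integral do rewrite /= ger0_norm ?sqr_ge0//.
  by rewrite Er ltry.
- by move=> z x y xy; rewrite lerD2r El// lerD2l ler_wpM2l.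
- move=> z x y xy; have : z + b * x <= z + b * y by rewrite lerD2l ler_wpM2l.
  by move=> /Eg; rewrite -!mulrA; lra.
Qed.

(** A positive multiple of an infinite value is infinite, so an expectation in System A must be
    finite. *)
Lemma EFin_eqM (a b : R) (x : \bar R) : 0 < b -> (a%:E = b%:E * x)%E -> x = (a / b)%:E.
Proof.
move=> b0; case: x => [x||]; last 2 first.
- by rewrite gt0_muley ?lte_fin.
- by rewrite gt0_muleNy ?lte_fin.
by rewrite -EFinM => -[->]; rewrite mulrC mulKf// gt_eqF.
Qed.

Lemma convex_env (l : R -> R) (tau : R) : convex_function (setT : set R^o) l -> 0 < tau ->
  [/\ {homo env' (EFin \o l) tau : x y / x <= y},
      {homo (fun x => tau^-1 * x - env' (EFin \o l) tau x) : x y / x <= y} &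
      exists x y, tau^-1 * x - env' (EFin \o l) tau x < tau^-1 * y - env' (EFin \o l) tau y].
Proof.
move=> /convex_functionR cl tau0.
have ffin : exists x, (EFin \o l) x != +oo%E by exists 0.
have lm := convexR_linear_minorant cl; have ec := convexR_econvex cl.
split; [exact: env'_nondecreasing|exact: env'_lipschitz|exact: prox_nonconstant].
Qed.

Lemma pcc_env (f : R -> \bar R) (tau : R) : proper_closed_convex f -> 0 < tau ->
  {homo env' f tau : x y / x <= y} /\
  {homo (fun x => tau^-1 * x - env' f tau x) : x y / x <= y}.
Proof.
move=> pcc tau0; have lm := pcc_linear_minorant pcc.
have [[_ ffin] _ ec] := pcc.
by split; [exact: env'_nondecreasing|exact: env'_lipschitz].
Qed.

Section system.
Variables (Ftheta Fz : probability T R) (ell : R -> R) (phi : R -> \bar R).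
Variables (cdelta alpha beta kappa nu : R).
Hypotheses (ell_convex : convex_function (setT : set R^o) ell).
Hypotheses (phi_pcc : proper_closed_convex phi) (cdelta_gt0 : 0 < cdelta).
Hypothesis sys : systemA Ftheta Fz ell phi cdelta alpha beta kappa nu.

Let alpha0 := systemA_alpha_gt0 sys.
Let beta0 := systemA_beta_gt0 sys.
Let kappa0 := systemA_kappa_gt0 sys.
Let nu0 := systemA_nu_gt0 sys.

Let score_sqr : (\int[Fz \x gamma]_w (score ell alpha kappa w.1 w.2 ^+ 2)%:E =
  (beta ^+ 2 / cdelta)%:E)%E.
Proof. by apply: EFin_eqM => //; have := systemA_beta sys; rewrite unlock. Qed.

Lemma score_energy : energy Fz (score ell alpha kappa) = beta ^+ 2 / cdelta.
Proof. by rewrite /energy score_sqr. Qed.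

Lemma score_gain : gain Fz (score ell alpha kappa) = nu * alpha / cdelta.
Proof.
by rewrite /gain; have := systemA_nu sys; rewrite unlock => /(EFin_eqM cdelta_gt0) ->.
Qed.

Lemma monoscore_score : monoscore Fz (alpha / kappa) (score ell alpha kappa).
Proof.
have [El Eg _] := convex_env ell_convex kappa0.
rewrite (_ : score _ _ _ = (fun z x => env' (EFin \o ell) kappa (z + alpha * x) - 0 * z)).
  rewrite mulrC; apply: (monoscore_affine (r := beta ^+ 2 / cdelta) El Eg (ltW alpha0)).
  by under eq_integral do rewrite mul0r subr0; exact: score_sqr.
by apply/funext => z; apply/funext => x; rewrite mul0r subr0.
Qed.

(** As [z + alpha * a] runs over the whole line, a score constant for one [z] would be constant for
    all, against its positive gain. *)
Lemma score_nonconstant z :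
  exists a b, score ell alpha kappa z a < score ell alpha kappa z b.
Proof.
apply: contrapT => /forallNP nc.
have : gain Fz (score ell alpha kappa) <= 0.
  apply: (gain_constant monoscore_score) => z' a b.
  have cst x y : env' (EFin \o ell) kappa x <= env' (EFin \o ell) kappa y.
    rewrite leNgt; apply/negP => lt.
    apply: (nc ((y - z) / alpha)); exists ((x - z) / alpha).
    have e w : z + alpha * ((w - z) / alpha) = w by field; rewrite gt_eqF.
    by rewrite /score !e.
  by apply/eqP; rewrite eq_le /score !cst.
by rewrite score_gain leNgt divr_gt0// mulr_gt0.
Qed.

(** For fixed [z] this is the nonconstant proximal map divided by [kappa], after an affine change of
    variable and up to an additive constant. *)
Lemma coscore_nonconstant z :
  exists a b, alpha / kappa * a - score ell alpha kappa z a <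
              alpha / kappa * b - score ell alpha kappa z b.
Proof.
have [_ _ [x [y xy]]] := convex_env ell_convex kappa0.
exists ((x - z) / alpha), ((y - z) / alpha).
have e w : alpha / kappa * ((w - z) / alpha) = kappa^-1 * w - kappa^-1 * z.
  by field; rewrite !gt_eqF.
have e' w : z + alpha * ((w - z) / alpha) = w by field; rewrite gt_eqF.
by rewrite /score !e !e'; lra.
Qed.

(* The residual is nonincreasing in h; its opposite has slopes between 0 and beta / nu. *)
Definition nresidual (theta h : R) : R := - residual phi beta nu theta h.

Let nresidual_sqr : (\int[Ftheta \x gamma]_w (nresidual w.1 w.2 ^+ 2)%:E =
  (alpha ^+ 2)%:E)%E.
Proof.
have := systemA_alpha sys; rewrite unlock => ->.
by apply: eq_integral => w _; rewrite sqrrN.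
Qed.

Lemma nresidual_energy : energy Ftheta nresidual = alpha ^+ 2.
Proof. by rewrite /energy nresidual_sqr. Qed.

Lemma nresidual_gain : gain Ftheta nresidual = kappa * beta.
Proof.
rewrite /gain -[RHS]/(fine (kappa * beta)%:E).
have := systemA_kappa sys; rewrite unlock => ->; congr fine.
by apply: eq_integral => w _; rewrite mulrN mulNr.
Qed.

(** The opposite of the residual is the proximal map at [theta + beta / nu * h] minus [theta], and
    the proximal map has slopes between 0 and 1. *)
Lemma monoscore_nresidual : monoscore Ftheta (beta / nu) nresidual.
Proof.
have nuV0 : 0 < nu^-1 by rewrite invr_gt0.
have [El Eg] := pcc_env phi_pcc nuV0; rewrite invrK in Eg.
pose E x := x - nu^-1 * env' phi nu^-1 x.
have nresE z x : nresidual z x = E (z + beta / nu * x) - 1 * z.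
  by rewrite /nresidual /residual /E; ring.
rewrite (_ : nresidual = fun z x => E (z + beta / nu * x) - 1 * z); last first.
  by apply/funext => z; apply/funext => x.
suff : monoscore Ftheta (1 * (beta / nu)) (fun z x => E (z + beta / nu * x) - 1 * z).
  by rewrite (mul1r (beta / nu)).
apply: (@monoscore_affine Ftheta E 1 (beta / nu) 1 (alpha ^+ 2)).
- move=> x y /Eg /(ler_wpM2l (ltW nuV0)).
  have e w v : nu^-1 * (nu * w - v) = w - nu^-1 * v by field; rewrite gt_eqF.
  by rewrite !e.
- by move=> x y xy; rewrite /E !mul1r !subKr; apply: ler_wpM2l (El _ _ xy); exact: ltW.
- by apply: divr_ge0; exact: ltW.
- by rewrite -nresidual_sqr; apply: eq_integral => w _; rewrite nresE mul1r.
Qed.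

End system.
End scores_of_system.

(** * Positive multiples of a correlation, the common form of [F_ell] and [F_phi] *)

Section scaled_correlation.
Context d (Z : measurableType d) (R : realType) (P : probability Z R).
Variables (K K' C : R) (f g : Z -> R -> R) (F : R -> R).
Hypotheses (sf : monoscore P K f) (sg : monoscore P K' g) (C0 : 0 < C).
Hypothesis FE : forall e, F e = C * corr P f g e.

Lemma scaled_corr_increment a b : -1 <= a <= 1 -> -1 <= b <= 1 -> a <= b ->
  0 <= F b - F a <= C * K' * gain P f * (b - a).
Proof.
move=> ha hb ab; rewrite !FE -mulrBr -!mulrA; apply/andP; split.
  apply: mulr_ge0; [exact: ltW|rewrite subr_ge0].
  exact: (corr_nondecreasing (monoscore_lip sf) (monoscore_lip sg)
    (monoscore_le sf) (monoscore_le sg) ha hb ab).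
by rewrite (ler_pM2l C0) mulrA; exact: (corr_increment_le sf sg ha hb ab).
Qed.

Lemma scaled_corr_increment_sym a b : -1 <= a <= 1 -> -1 <= b <= 1 -> a <= b ->
  0 <= F b - F a <= C * K * gain P g * (b - a).
Proof.
move=> ha hb ab; have /andP[-> _] := scaled_corr_increment ha hb ab.
rewrite !FE -mulrBr -!mulrA (ler_pM2l C0) mulrA.
exact: (corr_increment_le_sym sf sg ha hb ab).
Qed.

Lemma scaled_corr_increment_lt a b :
    (forall z, exists a b, f z a < f z b) ->
    (forall z, exists a b, K' * a - g z a < K' * b - g z b) ->
    -1 <= a <= 1 -> -1 <= b <= 1 -> a < b ->
  F b - F a < C * K' * gain P f * (b - a).
Proof.
move=> nf ng ha hb ab; rewrite !FE -mulrBr -!mulrA (ltr_pM2l C0) mulrA.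
exact: (corr_increment_lt sf sg nf ng ha hb ab).
Qed.

Lemma scaled_corr_bound e : -1 <= e <= 1 ->
  `|F e| <= Num.sqrt (C ^+ 2 * (energy P f * energy P g)).
Proof.
move=> he; rewrite -sqrtr_sqr ler_wsqrtr// FE exprMn ler_pM2l ?exprn_gt0//.
exact: (cauchy_schwarz_corr (monoscore_lip sf) (monoscore_lip sg) he).
Qed.

Lemma differentiable_within_scaled_corr : differentiable_within `[-1, 1] F.
Proof.
move=> x hx; have := differentiable_within_corr (monoscore_lip sf) (monoscore_lip sg) hx.
move=> /cvg_ex[l cl]; apply/cvg_ex; exists (C * l).
rewrite (_ : (fun y => _) = (fun y => C * ((corr P f g y - corr P f g x) / (y - x)))).
  exact: cvgMr.
by apply/funext => y; rewrite !FE -mulrBr -mulrA.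
Qed.

End scaled_correlation.

Theorem theorem1 (R : realType)
    (Ftheta Fz : probability (measurableTypeR R) R)
    (ell ellt : R -> R) (phi phit : R -> \bar R)
    (ell_convex : convex_function (setT : set R^o) ell)
    (ellt_convex : convex_function (setT : set R^o) ellt)
    (phi_pcc : proper_closed_convex phi)
    (phit_pcc : proper_closed_convex phit)
    (delta c ct : R) (delta_gt0 : 0 < delta)
    (c_itv : 0 < c <= 1) (ct_itv : 0 < ct <= 1)
    (alpha beta kappa nu alphat betat kappat nut : R)
    (sys : systemA Ftheta Fz ell phi (c * delta) alpha beta kappa nu)
    (syst : systemA Ftheta Fz ellt phit (ct * delta) alphat betat kappat nut) :
  let Fl := F_ell Fz delta c ct ell ellt alpha beta kappa alphat betat kappat in
  let Fp := F_phi Ftheta phi phit alpha beta nu alphat betat nut in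
  [/\ (forall eta, -1 <= eta <= 1 -> `|Fl eta| <= Num.sqrt (c * ct)) /\
      (forall eta, -1 <= eta <= 1 -> `|Fp eta| <= 1),

      [/\ {in `[-1, 1] &, {homo Fl : x y / x <= y}},
          {in `[-1, 1] &, {homo Fp : x y / x <= y}},
          differentiable_within `[-1, 1] Fl,
          differentiable_within `[-1, 1] Fp &
          (Num.min c ct).-lipschitz_(`[-1, 1]) (Fl \o Fp) /\
          (Num.min c ct).-lipschitz_(`[-1, 1]) (Fp \o Fl)] &

      exists etaG etaH : R,
        [/\ -1 <= etaG <= 1,
            - Num.sqrt (c * ct) <= etaH <= Num.sqrt (c * ct),
            -1 <= etaH <= 1,
            etaG = Fp etaH /\ etaH = Fl etaG &
            forall xG xH : R, -1 <= xG <= 1 -> -1 <= xH <= 1 ->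
              xG = Fp xH -> xH = Fl xG -> xG = etaG /\ xH = etaH]].
Proof.
move=> Fl Fp.
have /andP[c0 c1] := c_itv; have /andP[ct0 ct1] := ct_itv.
have cd0 : 0 < c * delta by rewrite mulr_gt0.
have ctd0 : 0 < ct * delta by rewrite mulr_gt0.
have [a0 b0 k0 n0 _ _ _ _] := sys; have [at0 bt0 kt0 nt0 _ _ _ _] := syst.
have sf := monoscore_score ell_convex cd0 sys.
have sg := monoscore_score ellt_convex ctd0 syst.
have sr := monoscore_nresidual phi_pcc sys.
have srt := monoscore_nresidual phit_pcc syst.
pose Cl := c * ct * delta / (beta * betat); pose Cp := (alpha * alphat)^-1.
have Cl0 : 0 < Cl by rewrite divr_gt0 ?mulr_gt0.
have Cp0 : 0 < Cp by rewrite invr_gt0 mulr_gt0.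
have FlE e : Fl e = Cl * corr Fz (score ell alpha kappa) (score ellt alphat kappat) e.
  by rewrite /Fl /F_ell unlock.
(* The two sign changes cancel in the product. *)
have FpE e : Fp e =
    Cp * corr Ftheta (nresidual phi beta nu) (nresidual phit betat nut) e.
  rewrite /Fp /F_phi unlock; congr (_ * fine _).
  by apply: eq_integral => w _; rewrite /nresidual mulrNN.
have Flb e : -1 <= e <= 1 -> `|Fl e| <= Num.sqrt (c * ct).
  move=> he; have := scaled_corr_bound sf sg Cl0 FlE he.
  rewrite (score_energy cd0 sys) (score_energy ctd0 syst) /Cl.
  congr (_ <= Num.sqrt _); field.
  by rewrite !gt_eqF.
have Fpb e : -1 <= e <= 1 -> `|Fp e| <= 1.
  move=> he; have := scaled_corr_bound sr srt Cp0 FpE he.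
  rewrite (nresidual_energy sys) (nresidual_energy syst) /Cp.
  rewrite [X in Num.sqrt X](_ : _ = 1) ?sqrtr1//; field.
  by rewrite !gt_eqF.
have cct1 : Num.sqrt (c * ct) <= 1.
  by rewrite -(@sqrtr1 R) ler_wsqrtr// mulr_ile1// ltW.
have FlI e : -1 <= e <= 1 -> -1 <= Fl e <= 1.
  by move=> he; rewrite -ler_norml (le_trans (Flb e he)).
have FpI e : -1 <= e <= 1 -> -1 <= Fp e <= 1.
  by move=> he; rewrite -ler_norml Fpb.
(* The two increment constants of [Fl], then those of [Fp], with the gains replaced by their values
   from System A. All parameters cancel in [A1 * B2 = ct] and [A2 * B1 = c]. *)
pose A1 := Cl * (alphat / kappat) * (nu * alpha / (c * delta)).
pose A2 := Cl * (alpha / kappa) * (nut * alphat / (ct * delta)).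
pose B1 := Cp * (betat / nut) * (kappa * beta).
pose B2 := Cp * (beta / nu) * (kappat * betat).
have Fl1 := scaled_corr_increment sf sg Cl0 FlE.
have Fl2 := scaled_corr_increment_sym sf sg Cl0 FlE.
have Fp1 := scaled_corr_increment sr srt Cp0 FpE.
have Fp2 := scaled_corr_increment_sym sr srt Cp0 FpE.
have Fls := scaled_corr_increment_lt sf sg Cl0 FlE
  (score_nonconstant ell_convex cd0 sys) (coscore_nonconstant ellt_convex syst).
rewrite (score_gain cd0 sys) -/A1 in Fl1 Fls.
rewrite (score_gain ctd0 syst) -/A2 in Fl2.
rewrite (nresidual_gain sys) -/B1 in Fp1.
rewrite (nresidual_gain syst) -/B2 in Fp2.
have [A10 A20 B10 B20] : [/\ 0 <= A1, 0 <= A2, 0 <= B1 & 0 <= B2].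
  by split; apply/ltW; rewrite !mulr_gt0 ?invr_gt0// mulr_gt0.
have AB12 : A1 * B2 = ct by rewrite /A1 /B2 /Cl /Cp; field; rewrite !gt_eqF.
have AB21 : A2 * B1 = c by rewrite /A2 /B1 /Cl /Cp; field; rewrite !gt_eqF.
have BA21 : B2 * A1 = ct by rewrite mulrC.
have BA12 : B1 * A2 = c by rewrite mulrC.
have Flle a b : -1 <= a <= 1 -> -1 <= b <= 1 -> a <= b -> Fl a <= Fl b.
  by move=> ha hb ab; have /andP[+ _] := Fl1 a b ha hb ab; rewrite subr_ge0.
have Fple a b : -1 <= a <= 1 -> -1 <= b <= 1 -> a <= b -> Fp a <= Fp b.
  by move=> ha hb ab; have /andP[+ _] := Fp1 a b ha hb ab; rewrite subr_ge0.
split; first by [].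
- split.
  + by move=> x y; rewrite !in_itv/=; exact: Flle.
  + by move=> x y; rewrite !in_itv/=; exact: Fple.
  + exact: (differentiable_within_scaled_corr sf sg FlE).
  + exact: (differentiable_within_scaled_corr sr srt FpE).
  (* Each composition has both Lipschitz constants, one for each crosswise pairing, hence the
     smaller one. *)
  + have lip_min (H : R -> R) :
      (forall x y, -1 <= x <= 1 -> -1 <= y <= 1 -> `|H x - H y| <= c * `|x - y|) ->
      (forall x y, -1 <= x <= 1 -> -1 <= y <= 1 -> `|H x - H y| <= ct * `|x - y|) ->
      (Num.min c ct).-lipschitz_(`[-1, 1]) H.
      move=> h1 h2 [x y] [/=]; rewrite !in_itv/= => hx hy.
      by case: (leP c ct) => _; [exact: h1|exact: h2].
    split; apply: lip_min.
    * exact: comp_lipschitz Fl2 Fp1 FpI A20 AB21.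
    * exact: comp_lipschitz Fl1 Fp2 FpI A10 AB12.
    * exact: comp_lipschitz Fp1 Fl2 FlI B10 BA12.
    * exact: comp_lipschitz Fp2 Fl1 FlI B20 BA21.
- have AB1 : A1 * B2 <= 1 by rewrite AB12.
  (* [etaH] is the fixed point of [Fl \o Fp]. The strict bound [Fls] has constant [A1], so it is
     paired with the bound of constant [B2]. *)
  have [y [yI yE yU]] := coupled_fixpoint Fls Flle Fp2 FlI FpI A10 AB1.
  exists (Fp y), y; split.
  + exact: FpI.
  + by rewrite -ler_norml -{1}yE; apply/Flb/FpI.
  + exact: yI.
  + by split; [|exact/esym].
  + move=> xG xH hG hH GE HE.
    have yH : xH = y by apply: (yU _ hH); rewrite -GE -HE.
    exact: (conj (etrans GE (congr1 Fp yH)) yH).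
Qed.
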